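(* For any $t \geq 0$, \textsc{1-Edge Contraction($\gamma_{t2}$)} is polynomial-time solvable on $(P_5 + tK_1)$-free graphs.
   Context: All graphs are finite, simple and connected. A semitotal dominating set of $G$ is a set $D\subseteq V(G)$ such that every vertex outside $D$ has a neighbour in $D$ and every vertex of $D$ is at distance at most two from another vertex of $D$; $\gamma_{t2}(G)$ is its minimum size. $ct_{\gamma_{t2}}(G)$ is the smallest $k$ such that contracting some $k$ edges of $G$ (contracting $uv$ replaces $u,v$ by one vertex adjacent to all neighbours of $u$ or $v$) yields $G'$ with $\gamma_{t2}(G')<\gamma_{t2}(G)$. \textsc{1-Edge Contraction($\gamma_{t2}$)}: given $G$, decide whether $ct_{\gamma_{t2}}(G)\leq 1$. $P_5+tK_1$ is the disjoint union of a path on five vertices and $t$ isolated vertices. *)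

(* Defs.v *)
From mathcomp Require Import all_boot.
Set Implicit Arguments. Unset Strict Implicit. Unset Printing Implicit Defensive.

(* A graph: a finite vertex type with an adjacency relation.  All graphs we
   build are simple: the input graph is assumed symmetric and irreflexive,
   and contraction (below) preserves both properties. *)
Record sgraph := SGraph { sV : finType; sadj : rel sV }.

Definition within2 (G : sgraph) (x y : sV G) : bool :=
  (x != y) && (@sadj G x y || [exists w, @sadj G x w && @sadj G w y]).

Definition semitotal_dom (G : sgraph) (D : {set sV G}) : bool :=
  [forall x, (x \notin D) ==> [exists y in D, @sadj G x y]] &&
  [forall x in D, exists y in D, within2 x y].

(* gamma_t2(H) < gamma_t2(G): some semitotal dominating set of H is smaller
   than every semitotal dominating set of G *)
Definition gt2_lt (H G : sgraph) : Prop :=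
  exists D : {set sV H}, semitotal_dom D /\
    forall D' : {set sV G}, semitotal_dom D' -> #|D| < #|D'|.

(* contraction of the edge uv: v is deleted, u becomes the merged vertex,
   adjacent to all neighbours of u or v *)
Definition contract (G : sgraph) (u v : sV G) : sgraph :=
  @SGraph {x : sV G | x != v}
    (fun x y => (val x != val y) &&
       [|| @sadj G (val x) (val y),
           (val x == u) && @sadj G v (val y)
         | (val y == u) && @sadj G (val x) v]).

Fixpoint after_contractions (k : nat) (G : sgraph) (P : sgraph -> Prop) : Prop :=
  match k with
  | 0 => P G
  | k'.+1 => exists u v : sV G, @sadj G u v /\
              after_contractions k' (contract u v) P
  end.

(* ct_{gamma_t2}(G) <= k  (ct is the least such number of contractions) *)
Definition ct_gt2_le (G : sgraph) (k : nat) : Prop :=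
  exists j, j <= k /\ after_contractions j G (fun H => gt2_lt H G).

Definition P5tK1 (t : nat) : rel 'I_(5 + t) :=
  fun i j => (i < 5) && (j < 5) && ((i == j.+1 :> nat) || (j == i.+1 :> nat)).

Arguments P5tK1 t : clear implicits.

Definition induced_sub (m : nat) (H : rel 'I_m) (G : sgraph) : Prop :=
  exists f : 'I_m -> sV G, injective f /\
    forall i j, @sadj G (f i) (f j) = H i j.

Definition Hfree (m : nat) (H : rel 'I_m) (G : sgraph) : Prop :=
  ~ induced_sub H G.

Definition tsym := option bool.          (* None = blank *)
Inductive tdir := TLeft | TRight | TStay.

Record TM := {
  tm_nq : nat;                            (* states 'I_(tm_nq.+1), start = ord0 *)
  tm_delta : 'I_tm_nq.+1 -> tsym -> option ('I_tm_nq.+1 * tsym * tdir)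
  (* None = halt *)
}.

Record config (M : TM) := Config {
  c_state : 'I_(tm_nq M).+1;
  c_left : seq tsym;   (* cells left of the head, nearest first *)
  c_head : tsym;
  c_right : seq tsym   (* cells right of the head, nearest first *)
}.

Definition tm_step (M : TM) (c : config M) : option (config M) :=
  match tm_delta (c_state c) (c_head c) with
  | None => None
  | Some (q, s, d) =>
    Some match d with
    | TStay => Config q (c_left c) s (c_right c)
    | TLeft => match c_left c with
               | [::] => Config q [::] None (s :: c_right c)
               | a :: l => Config q l a (s :: c_right c)
               end
    | TRight => match c_right c with
                | [::] => Config q (s :: c_left c) None [::]
                | a :: r => Config q (s :: c_left c) a r
                end
    end
  end.

Fixpoint tm_run (M : TM) (T : nat) (c : config M) : option (config M) :=
  match tm_step c with
  | None => Some c
  | Some c' => if T is T'.+1 then tm_run T' c' else None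
  end.

Definition tm_init (M : TM) (w : seq bool) : config M :=
  match w with
  | [::] => Config (ord0 : 'I_(tm_nq M).+1) [::] None [::]
  | b :: w' => Config (ord0 : 'I_(tm_nq M).+1) [::] (Some b) (map Some w')
  end.

Definition tm_decides_in (M : TM) (w : seq bool) (T : nat) (b : bool) : Prop :=
  exists c, tm_run T (tm_init M w) = Some c /\ b = (c_head c == Some true).

Definition encode_graph (n : nat) (e : rel 'I_n) : seq bool :=
  [seq e i j | i <- enum 'I_n, j <- enum 'I_n].

(* Main.v *)
Require Import Defs.
From Stdlib Require Import ZArith Lia.
From mathcomp Require Import all_boot zify.
Set Implicit Arguments. Unset Strict Implicit. Unset Printing Implicit Defensive.

(* On the class of connected (P_5 + tK_1)-free graphs, ct <= 1 is equivalent to a fixed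
   first-order sentence, and first-order sentences are checked in polynomial time.

   If such a graph contains an induced P_5, a maximal independent set outside the closed
   neighbourhood of this P_5 has fewer than t vertices, which yields a semitotal dominating
   set of size at most 2t + 5; then only boundedly many sizes of sets have to be compared.
   If the graph is P_5-free and has no semitotal dominating set of size 2, then ct <= 1: any
   semitotal dominating set D can be modified, without growing, into one containing an edge
   uv and a third vertex at distance at most 2 from u or v, and contracting uv saves a
   vertex. If two vertices of D are at distance 3, the interior of a shortest path between
   them dominates what they dominate and replaces them; otherwise the vertices of D are
   pairwise at distance 2, and common neighbours of three of them serve for the exchange.

   For the machine, the input is copied into blocks of K cells, which carry registers in
   unary; programs with bounded loops over such registers evaluate first-order formulas by
   running through all assignments. *)

(** * Semitotal domination in graphs without long induced paths *)

(** A fixed sentence cannot compare two unbounded minima, so the sizes that matter must be bounded.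
    The bound 2t + 5 counts the five path vertices, the independent set, and one neighbour of each
    of its members, added as a partner within distance two. If all semitotal dominating sets exceed
    it, the answer is yes as soon as there is an edge; a connected graph without edges offers
    nothing to contract.

    Contracting an edge inside D saves a vertex, but its ends may have been each other's only
    partner. The third vertex near the edge supplies a new partner; this is why sets of size two are
    the exception, and why each exchange has to preserve domination, partners and size at once.

    A one-tape machine has no random access. Registers are therefore marks whose position is their
    value, in blocks that also carry the input bits: reading the bit indexed by a register is a walk
    to its mark, and comparing two registers is a search for one mark starting from the other. The
    order n is not written in the input and has to be recovered from the length n^2. *)

Section Graphs.
Variables (V : finType) (e : rel V).
Hypotheses (sym_e : symmetric e) (irr_e : irreflexive e).
Let G := SGraph e.
Implicit Types (D : {set V}).

Definition near x y := (x == y) || e x y.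

Definition dominating D := [forall x, [exists y in D, near x y]].

Lemma dominatingP D :
  reflect (forall x, exists2 y, y \in D & near x y) (dominating D).
Proof.
apply: (iffP forallP) => H x; first by have /existsP[y /andP[]] := H x; exists y.
by have [y yD xy] := H x; apply/existsP; exists y; rewrite yD.
Qed.

Lemma within2P (x y : V) :
  reflect (x <> y /\ (e x y \/ exists2 w, e x w & e w y)) (@within2 G x y).
Proof.
rewrite /within2 /=; apply: (iffP andP) => [[/eqP ? /orP[? | /existsP[w /andP[]]]]|].
- by split=> //; left.
- by split=> //; right; exists w.
case=> /eqP ? [xy | [w xw wy]]; split=> //; first by rewrite xy.
by apply/orP; right; apply/existsP; exists w; rewrite xw wy.
Qed.

Lemma edge_within2 (x y : V) : e x y -> @within2 G x y.
Proof.
by move=> xy; apply/within2P; split; [move=> E; rewrite E irr_e in xy | left].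
Qed.

Lemma semitotalP D :
  reflect (dominating D /\ (forall x, x \in D -> exists2 y, y \in D & @within2 G x y))
          (@semitotal_dom G D).
Proof.
rewrite /semitotal_dom; apply: (iffP andP) => -[H1 H2]; split.
- apply/dominatingP => x; case: (boolP (x \in D)) => xD.
    by exists x => //; rewrite /near eqxx.
  have /implyP/(_ xD)/existsP[y /andP[yD xy]] := forallP H1 x.
  by exists y => //; apply/orP; right.
- by move=> x xD; have /implyP/(_ xD)/existsP[y /andP[]] := forallP H2 x; exists y.
- apply/forallP => x; apply/implyP => xD; have [y yD xy] := dominatingP _ H1 x.
  apply/existsP; exists y; rewrite yD; case/orP: xy => // /eqP E.
  by rewrite E yD in xD.
- apply/forallP => x; apply/implyP => xD; have [y yD xy] := H2 x xD.
  by apply/existsP; exists y; rewrite yD.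
Qed.

(* [D] with [u], [v] merged is still semitotal after contracting [uv], thanks to [w]. *)
Definition friendly D (u v w : V) :=
  [/\ [/\ u \in D, v \in D & w \in D], e u v, w != u, w != v &
      @within2 G u w || @within2 G v w].

(** * Contraction of an edge inside a semitotal dominating set *)

Section Contract.
Variables (u v : V) (uv : e u v).
Let H := @contract G u v.

Lemma neq_uv : u != v.
Proof. by apply: contraTneq uv => ->; rewrite irr_e. Qed.

(** The quotient map of the contraction: [insub] fails only at [v], which is sent to [u]. *)
Definition merge (x : V) : sV H :=
  if insub x is Some y then y else Sub u neq_uv.

Lemma val_merge x : val (merge x) = if x == v then u else x.
Proof.
rewrite /merge; case: insubP => [y xv ->|]; first by rewrite (negPf xv).
by rewrite negbK => /eqP ->; rewrite eqxx.
Qed.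

Lemma mergeK (y : sV H) : merge (val y) = y.
Proof. by apply: val_inj; rewrite val_merge (negPf (valP y)). Qed.

Lemma merge_edge x y : e x y -> merge x != merge y -> @sadj H (merge x) (merge y).
Proof.
move=> xy nxy; rewrite /= !val_merge.
move: nxy; rewrite -val_eqE /= !val_merge.
case: (altP (x =P v)) => [Ex|nx]; case: (altP (y =P v)) => [Ey|ny] -> //=;
  rewrite ?eqxx /= -?Ex -?Ey ?xy ?orbT //.
by rewrite Ex Ey irr_e in xy.
Qed.

(** A path of length two is mapped to such a path, unless its midpoint is merged with an end; then
    the remaining edge joins the two images. *)
Lemma merge_within2 x y :
  @within2 G x y -> merge x != merge y -> @within2 H (merge x) (merge y).
Proof.
move=> /within2P[_ xy] nxy; rewrite /within2 nxy andTb.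
case: xy => [xy | [w xw wy]]; first by rewrite (merge_edge xy nxy).
case: (altP (merge x =P merge w)) => [E|nxw].
  by rewrite E in nxy *; rewrite (merge_edge wy nxy).
case: (altP (merge w =P merge y)) => [E|nwy].
  by rewrite E in nxw; rewrite -E in nxw *; rewrite (merge_edge xw nxw).
apply/orP; right; apply/existsP; exists (merge w).
by rewrite (merge_edge xw nxw) (merge_edge wy nwy).
Qed.

(** The image of [D] works, and it is smaller because [u] and [v] have the same image. A vertex of
    [D] other than [u], [v] stays distinct from the image of its partner; only the merged vertex can
    lose its partners, and it receives [w]. *)
Lemma contract_semitotal D w : friendly D u v w -> @semitotal_dom G D ->
  exists2 D' : {set sV H}, @semitotal_dom H D' & #|D'| < #|D|.
Proof.
move=> [[uD vD wD] _ wu wv uvw] /semitotalP[domD D2].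
have merge_uv : merge u = merge v.
  by apply: val_inj; rewrite !val_merge eqxx (negPf neq_uv).
exists (merge @: D); last first.
  have -> : merge @: D = merge @: (D :\ v).
    apply/setP => z; apply/imsetP/imsetP => -[x xD ->]; last first.
      by exists x => //; case/setD1P: xD.
    case: (altP (x =P v)) => [->|xv]; last by exists x => //; rewrite !inE xv.
    by exists u; rewrite ?merge_uv // !inE neq_uv.
  apply: leq_ltn_trans (leq_imset_card _ _) _.
  by rewrite [X in _ < X](cardsD1 v) vD.
rewrite /semitotal_dom; apply/andP; split; apply/forallP => z; apply/implyP => zD.
  have [y yD] := dominatingP _ domD (val z).
  rewrite /near => /orP[/eqP E|zy].
    by rewrite -(mergeK z) E imset_f in zD.
  apply/existsP; exists (merge y); rewrite imset_f // andTb.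
  rewrite -{1}(mergeK z); apply: merge_edge => //; rewrite mergeK.
  by apply: contraNneq zD => ->; apply: imset_f.
case/imsetP: zD => x xD ->.
have key : exists2 y, y \in D & @within2 H (merge x) (merge y).
  case: (boolP ((x == u) || (x == v))) => [xuv|].
    have nw : merge u != merge w.
      by rewrite -val_eqE /= !val_merge (negPf neq_uv) (negPf wv) eq_sym.
    have -> : merge x = merge u by case/orP: xuv => /eqP ->.
    exists w => //; case/orP: uvw => H2; first exact: merge_within2.
    by rewrite merge_uv; apply: merge_within2; rewrite -?merge_uv.
  rewrite negb_or => /andP[xu xv]; have [y yD xy] := D2 x xD.
  exists y => //; apply: merge_within2 => //.
  rewrite -val_eqE /= !val_merge (negPf xv); case: ifP => // _.
  by case/andP: xy.
case: key => y yD xy; apply/existsP; exists (merge y).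
by rewrite imset_f.
Qed.
End Contract.

Definition inducedP5 (a b c d f : V) :=
  [/\ e a b, e b c, e c d & e d f] /\
  [/\ ~~ e a c, ~~ e a d, ~~ e a f, ~~ e b d & ~~ e b f] /\ ~~ e c f.

(** * Exchange arguments in connected P_5-free graphs *)

Section P5free.
Hypothesis conn : forall x y, connect e x y.
Hypothesis P5free : forall a b c d f, ~ inducedP5 a b c d f.

(** Induction along a path from [x]: if [z] follows [q] and [x a b q] has no shortcut, then
    [x a b q z] would be an induced P_5 unless a chord brings [z] back to distance at most three. *)
Lemma dist_le3 x y : [\/ x = y, @within2 G x y |
  exists a b, [/\ e x a, e a b & e b y]].
Proof.
have [p] := connectP (conn x y).
elim/last_ind: p y => [|p z IH] y /=; first by move=> _ ->; constructor 1.
rewrite rcons_path last_rcons => /andP[xp pz] ->.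
set q := last x p in pz; have {IH} := IH q xp erefl.
case: (altP (x =P z)) => [->|/eqP xz]; first by constructor 1.
have w2 a : e x a -> e a z -> @within2 G x z.
  by move=> xa az; apply/within2P; split=> //; right; exists a.
case=> [Eq | /within2P[_ [xq | [a xa aq]]] | [a [b [xa ab bq]]]].
- by constructor 2; apply: edge_within2; rewrite Eq.
- by constructor 2; apply: (w2 q).
- by constructor 3; exists a, q.
case xb: (e x b); first by constructor 3; exists b, q.
case xq: (e x q); first by constructor 2; apply: (w2 q).
case aq: (e a q); first by constructor 3; exists a, q.
case xz': (e x z); first by constructor 2; apply: edge_within2.
case az: (e a z); first by constructor 2; apply: (w2 a).
case bz: (e b z); first by constructor 3; exists a, b.
case: (@P5free x a b q z); split; last split; rewrite ?xb ?xq ?xz' ?aq ?az ?bz //.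
Qed.

Lemma card_swap1 D x a : x \in D -> #|a |: (D :\ x)| <= #|D|.
Proof.
by move=> xD; have := cardsD1 x D; rewrite xD cardsU1; case: (_ \notin _) => /=; lia.
Qed.

Lemma card_swap D x y a b : x \in D -> y \in D -> x != y ->
  #|a |: (b |: (D :\ x :\ y))| <= #|D|.
Proof.
move=> xD yD xy; have := cardsD1 x D; have := cardsD1 y (D :\ x).
rewrite !inE eq_sym xy yD xD /= => -> ->.
have := cardsU1 a (b |: (D :\ x :\ y)); have := cardsU1 b (D :\ x :\ y).
by move=> -> ->; do 2 case: (_ \notin _) => /=; lia.
Qed.

(** Only vertices all of whose dominators in [D] are [x] or [y] can lose domination, so [X] is
    tested on these alone. *)
Lemma dominating_swap D x y (X : {set V}) :
  dominating D ->
  (forall q, near q x || near q y ->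
     (forall z, z \in D -> z != x -> z != y -> ~~ near q z) ->
     exists2 z, z \in X & near q z) ->
  dominating (X :|: (D :\ x :\ y)).
Proof.
move=> /dominatingP domD key; apply/dominatingP => q.
case: (boolP [exists z in D, [&& z != x, z != y & near q z]]).
  case/existsP=> z /and4P[zD zx zy qz].
  by exists z => //; rewrite !inE zD zx zy orbT.
move/existsPn => nq; have [z zX qz] : exists2 z, z \in X & near q z.
  apply: key.
    have [z zD qz] := domD q; have := nq z; rewrite zD qz andbT /= negb_and !negbK.
    by case/orP=> /eqP <-; rewrite qz ?orbT.
  by move=> z zD zx zy; have := nq z; rewrite zD zx zy.
by exists z; rewrite // inE zX.
Qed.

Lemma dominating_swap2 D x y a b :
  dominating D ->
  (forall q, near q x || near q y ->
     (forall z, z \in D -> z != x -> z != y -> ~~ near q z) -> near q a || near q b) ->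
  dominating (a |: (b |: (D :\ x :\ y))).
Proof.
move=> domD key; rewrite setUA; apply: dominating_swap => // q qxy nq.
by case/orP: (key q qxy nq) => ?; [exists a | exists b]; rewrite ?inE ?eqxx ?orbT.
Qed.

(** A neighbour [q] of [x] adjacent to neither [a] nor [b] would give the induced path [q x a b y],
    and symmetrically for [y]. The new vertices are adjacent, hence partners of each other. *)
Lemma far_pair D x y a b : @semitotal_dom G D -> x \in D -> y \in D -> x != y ->
  ~~ @within2 G x y -> e x a -> e a b -> e b y ->
  @semitotal_dom G (a |: (b |: (D :\ x :\ y))).
Proof.
move=> /semitotalP[domD D2] xD yD xy nw xa ab bt.
have nxy : ~~ e x y by apply: contra nw => /edge_within2.
have n2 w : e x w -> ~~ e w y.
  move=> xw; apply: contra nw => wy; apply/within2P; split; first exact/eqP.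
  by right; exists w.
have nay := n2 a xa.
have nxb : ~~ e x b by apply: contraL bt => /n2.
have nbr q : near q x || near q y -> near q a || near q b.
  rewrite /near; case/orP=> /orP[/eqP ->|qx].
  - by rewrite xa orbT.
  - case qa: (e q a); rewrite ?orbT //; case qb: (e q b); rewrite ?orbT //.
    case: (@P5free q x a b y); do !split => //; rewrite ?qa ?qb //.
    by apply: n2; rewrite sym_e.
  - by rewrite (sym_e y b) bt !orbT.
  - case qa: (e q a); rewrite ?orbT //; case qb: (e q b); rewrite ?orbT //.
    case: (@P5free q y b a x); do !split => //; rewrite ?qa ?qb // 1?sym_e //.
    by apply: contraL qx => ?; apply: n2.
apply/semitotalP; split; first by apply: dominating_swap2 => // q ? _; apply: nbr.
(* Serves the vertices whose partner was [x] or [y]: the next vertex [z] on a path of length at most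
   two towards that partner is near it, hence equal or adjacent to [a] or [b]. *)
have near2 z : near z x || near z y -> forall r, e r z -> r != a -> r != b ->
    exists2 y0, y0 \in a |: (b |: (D :\ x :\ y)) & @within2 G r y0.
  move=> zxy r rz ra rb.
  have aux c : near z c -> r != c -> @within2 G r c.
    case/orP=> [/eqP <- _|zc rc]; first exact: edge_within2.
    by apply/within2P; split; [apply/eqP | right; exists z].
  by case/orP: (nbr z zxy) => /aux w2; [exists a | exists b];
    rewrite ?w2 // !inE eqxx ?orbT.
move=> z; rewrite !inE => zD.
case: (altP (z =P a)) => [->|za].
  by exists b; [rewrite !inE eqxx ?orbT | apply: edge_within2].
case: (altP (z =P b)) => [->|zb].
  by exists a; [rewrite !inE eqxx ?orbT | apply: edge_within2; rewrite sym_e].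
move: zD; rewrite (negPf za) (negPf zb) /= => /and3P[zy zx zD].
have [w wD zw] := D2 z zD.
case: (boolP ((w == x) || (w == y))) => [wxy|]; last first.
  by rewrite negb_or => /andP[wx wy]; exists w; rewrite // !inE wD wx wy !orbT.
have wn : near w x || near w y.
  by case/orP: wxy => /eqP ->; rewrite /near eqxx ?orbT.
case/within2P: zw => _ [zw | [r zr rw]]; first exact: near2 zw za zb.
apply: (near2 r _ z zr za zb).
by case/orP: wxy => /eqP <-; rewrite /near rw ?orbT.
Qed.

Hypothesis no_pair : forall D, @semitotal_dom G D -> 2 < #|D|.

(** If the third vertex [w] is far from both ends, [u] and [w] are exchanged for the interior [a],
    [b] of a path between them. The edge [a b] then has [v] as its third vertex: [v] is adjacent to
    [a], since otherwise [v u a b w] would be an induced P_5. *)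
Lemma friendly_of_edge D u v : @semitotal_dom G D -> u \in D -> v \in D -> e u v ->
  exists D' u' v' w', [/\ @semitotal_dom G D', #|D'| <= #|D| & friendly D' u' v' w'].
Proof.
move=> sD uD vD uv; have uv' : u != v by apply: contraTneq uv => ->; rewrite irr_e.
have [w wD /andP[wu wv]] : exists2 w, w \in D & (w != u) && (w != v).
  have : 0 < #|D :\ u :\ v|.
    have := no_pair sD; rewrite (cardsD1 u) (cardsD1 v (D :\ u)) !inE uD vD eq_sym uv' /=.
    by lia.
  by case/card_gt0P=> w; rewrite !inE => /and3P[? ? ?]; exists w => //; apply/andP.
case: (boolP (@within2 G u w || @within2 G v w)) => [w2|].
  by exists D, u, v, w; split.
rewrite negb_or => /andP[nuw nvw].
have [a [b [ua ab bw]]] : exists a b, [/\ e u a, e a b & e b w].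
  case: (dist_le3 u w) => // [E|]; first by rewrite E eqxx in wu.
  by rewrite (negPf nuw).
have naw : ~~ e a w.
  apply: contra nuw => aw; apply/within2P; split; last by right; exists a.
  by apply/eqP; rewrite eq_sym.
have nvb : ~~ e v b.
  apply: contra nvw => vb; apply/within2P; split; last by right; exists b.
  by apply/eqP; rewrite eq_sym.
have nub : ~~ e u b.
  apply: contra nuw => vb; apply/within2P; split; last by right; exists b.
  by apply/eqP; rewrite eq_sym.
have nvw' : ~~ e v w by apply: contra nvw => /edge_within2.
have nuw' : ~~ e u w by apply: contra nuw => /edge_within2.
have va : e v a.
  apply: contraT => nva; case: (@P5free v u a b w).
  by do !split => //; rewrite sym_e.
have uw : u != w by rewrite eq_sym.
exists (a |: (b |: (D :\ u :\ w))), a, b, v; split.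
- exact: far_pair.
- exact: card_swap.
split=> //; rewrite ?inE ?eqxx ?orbT //.
- by split=> //; rewrite (eq_sym v w) wv (eq_sym v u) uv' vD !orbT.
- by apply: contraTneq va => ->; rewrite irr_e.
- by apply: contraNneq nvw' => ->.
- by rewrite edge_within2 // sym_e.
Qed.

Lemma friendly_exists D : @semitotal_dom G D ->
  exists D' u v w, [/\ @semitotal_dom G D', #|D'| <= #|D| & friendly D' u v w].
Proof.
move=> sD.
have le_edge D' u v : @semitotal_dom G D' -> #|D'| <= #|D| -> u \in D' -> v \in D' -> e u v ->
  exists D' u v w, [/\ @semitotal_dom G D', #|D'| <= #|D| & friendly D' u v w].
  move=> sD' le uD vD uv; have [E [u' [v' [w' [? leE ?]]]]] := friendly_of_edge sD' uD vD uv.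
  by exists E, u', v', w'; split=> //; apply: leq_trans leE le.
case: (boolP [exists x in D, exists y in D, e x y]) => [|noedge].
  by case/existsP=> x /andP[xD /existsP[y /andP[yD xy]]]; apply: (le_edge D x y).
have {}noedge x y : x \in D -> y \in D -> ~~ e x y.
  move=> xD yD; have /existsPn/(_ x) := noedge; rewrite xD /= => /existsPn/(_ y).
  by rewrite yD.
case: (boolP [exists x in D, exists y in D, (x != y) && ~~ @within2 G x y]) => [|w2].
  case/existsP=> x /andP[xD /existsP[y /and3P[yD xy nw]]].
  have [a [b [xa ab bt]]] : exists a b, [/\ e x a, e a b & e b y].
    by case: (dist_le3 x y) => // [E|]; [rewrite E eqxx in xy | rewrite (negPf nw)].
  apply: (le_edge (a |: (b |: (D :\ x :\ y))) a b) => //.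
  - exact: (far_pair sD xD yD xy nw xa ab bt).
  - exact: card_swap.
  - by rewrite !inE eqxx.
  - by rewrite !inE eqxx ?orbT.
have {}w2 x y : x \in D -> y \in D -> x != y -> @within2 G x y.
  move=> xD yD xy; have /existsPn/(_ x) := w2; rewrite xD /= => /existsPn/(_ y).
  by rewrite yD xy /= negbK.
have common x y : x \in D -> y \in D -> x != y -> exists2 c, e x c & e c y.
  move=> xD yD xy; have /within2P[_ [|//]] := w2 x y xD yD xy.
  by rewrite (negPf (noedge _ _ xD yD)).
have domD : dominating D by case/semitotalP: sD.
have [a [b [d [[aD bD dD] [ab bd da]]]]] : exists a b d,
    [/\ a \in D, b \in D & d \in D] /\ [/\ a != b, b != d & d != a].
  by have /card_gt2P[a [b [d [? ?]]]] := no_pair sD; exists a, b, d.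
have ba : b != a by rewrite eq_sym.
have db : d != b by rewrite eq_sym.
have ad : a != d by rewrite eq_sym.
case: (boolP [exists c, [&& e a c, e b c & e d c]]) => [|no3].
  (* Case of a common neighbour [c]. Either [c] can replace [a], which creates the edge [c b], or
     some [p] not adjacent to [c] is dominated by [a] alone; then [b] and [d] are exchanged for [c]
     and [p], and [a c] is the edge, with [p] next to [a]. *)
  case/existsP=> c /and3P[ac bc dc].
  have cn z : z \in D -> c != z.
    by move=> zD; apply: contraTneq ac => ->; apply: noedge.
  case: (boolP (dominating (c |: (D :\ a)))) => [dom|].
    apply: (le_edge (c |: (D :\ a)) c b) => //; first last.
    - by rewrite sym_e.
    - by rewrite !inE ba bD orbT.
    - by rewrite !inE eqxx.
    - exact: card_swap1.
    apply/semitotalP; split=> // z; rewrite !inE => zD.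
    case: (altP (z =P c)) zD => [-> _|zc /=/andP[za zD]].
      by exists b; rewrite ?inE ?ba ?bD ?orbT // edge_within2 // sym_e.
    case: (altP (z =P b)) => [->|zb].
      by exists c; rewrite ?inE ?eqxx // edge_within2.
    by exists b; rewrite ?inE ?ba ?bD ?orbT // w2.
  move/forallPn=> [p /existsPn np].
  have npc : ~~ near p c by have := np c; rewrite !inE eqxx.
  have npD z : z \in D -> z != a -> ~~ near p z.
    by move=> zD za; have := np z; rewrite !inE za zD orbT.
  have pa : e p a.
    have [z zD pz] := dominatingP _ domD p.
    have Ez : z = a by apply/eqP; apply: contraLR pz => /(npD z zD).
    rewrite Ez in pz; case/orP: pz => // /eqP E.
    by rewrite E /near ac orbT in npc.
  move: npc; rewrite /near negb_or => /andP[pc npc].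
  exists (c |: (p |: (D :\ b :\ d))), a, c, p; split; last 1 first.
  - split=> //; rewrite ?inE ?eqxx ?ab ?ad ?aD ?orbT //.
      by apply: contraTneq pa => ->; rewrite irr_e.
    by rewrite edge_within2 // sym_e.
  - apply/semitotalP; split.
      apply: dominating_swap2 => // q qbd nq.
      have nqa : ~~ e q a by apply: contra (nq a aD ab ad) => qa; rewrite /near qa orbT.
      (* Applied to [b] and [d]: a [q] adjacent to [z] but to neither [c] nor [p] would end the
         induced path [p a c z q]. *)
      have key z : z \in D -> z != a -> e z c -> near q z -> near q c || near q p.
        move=> zD za zc; case/orP=> [/eqP ->|qz]; first by rewrite /near zc orbT.
        rewrite /near; case qc: (e q c); rewrite ?orbT //.
        case qp: (e q p); rewrite ?orbT //.
        case: (@P5free p a c z q); do !split => //.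
        + by rewrite sym_e.
        + by rewrite sym_e.
        + by have := npD z zD za; rewrite negb_or => /andP[].
        + by rewrite sym_e qp.
        + exact: noedge.
        + by rewrite sym_e.
        + by rewrite sym_e qc.
      by case/orP: qbd; apply: key.
    have aX : a \in c |: (p |: (D :\ b :\ d)) by rewrite !inE ab ad aD !orbT.
    move=> z; rewrite !inE => zD.
    case: (altP (z =P c)) zD => [-> _|zc /=].
      by exists a => //; apply: edge_within2; rewrite sym_e.
    case: (altP (z =P p)) => [-> _|zp /=/and3P[zd zb zD]].
      by exists a => //; apply: edge_within2.
    case: (altP (z =P a)) => [->|za]; last by exists a => //; apply: w2.
    by exists c; rewrite ?inE ?eqxx // edge_within2.
  - exact: card_swap.
(* Case without a common neighbour. Below, [c1] and [c2] are adjacent because [a c1 b c2 d] cannot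
   be induced; they replace [a] and [d], with [b] as third vertex. *)
have {}no3 c : e a c -> e b c -> ~~ e d c.
  by move=> ac bc; have /existsPn/(_ c) := no3; rewrite ac bc.
have nab := noedge _ _ aD bD; have nba := noedge _ _ bD aD.
have nad := noedge _ _ aD dD; have nda := noedge _ _ dD aD.
have nbd := noedge _ _ bD dD.
have [c1 ac1 c1b] := common a b aD bD ab.
have [c2 bc2 c2d] := common b d bD dD bd.
have nc1d : ~~ e c1 d by rewrite sym_e; apply: no3; rewrite // sym_e.
have nac2 : ~~ e a c2 by apply: contraL c2d => ac2; rewrite sym_e; apply: no3.
have c12 : e c1 c2.
  apply: contraT => n12; case: (@P5free a c1 b c2 d); do !split => //; exact: noedge.
exists (c1 |: (c2 |: (D :\ a :\ d))), c1, c2, b; split; last 1 first.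
- split=> //; rewrite ?inE ?eqxx ?ba ?bd ?bD ?orbT //.
  + by apply: contraTneq c1b => <-; rewrite irr_e.
  + by apply: contraTneq bc2 => <-; rewrite irr_e.
  + by rewrite edge_within2.
- apply/semitotalP; split.
    apply: dominating_swap2 => // q qad nq.
    have nqb : ~~ e q b by apply: contra (nq b bD ba bd) => qb; rewrite /near qb orbT.
    rewrite /near; case qc1: (e q c1); rewrite ?orbT //; case qc2: (e q c2); rewrite ?orbT //.
    have qa' : q != a by apply: contraFneq qc1 => ->.
    have qd' : q != d by apply: contraFneq qc2 => ->; rewrite sym_e.
    move: qad; rewrite /near (negPf qa') (negPf qd') /=.
    (* A [q] missed by [b], [c1] and [c2] lies on an induced P_5, whether it sees both [a] and [d],
       only [a], or only [d]. *)
    case qa: (e q a); case qd: (e q d) => //= _; exfalso.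
    + by case: (@P5free b c1 a q d); do !split => //; rewrite 1?sym_e ?qc1.
    + by case: (@P5free q a c1 c2 d); do !split => //; rewrite ?qc1 ?qc2 ?qd.
    + by case: (@P5free q d c2 c1 a); do !split => //; rewrite ?qc1 ?qc2 ?qa // sym_e.
  have bX : b \in c1 |: (c2 |: (D :\ a :\ d)) by rewrite !inE ba bd bD !orbT.
  move=> z; rewrite !inE => zD.
  case: (altP (z =P c1)) zD => [-> _|zc /=].
    by exists b => //; apply: edge_within2.
  case: (altP (z =P c2)) => [-> _|zp /=/and3P[zd za zD]].
    by exists b => //; apply: edge_within2; rewrite sym_e.
  case: (altP (z =P b)) => [->|zb]; last by exists b => //; apply: w2.
  by exists c2; rewrite ?inE ?eqxx ?orbT // edge_within2.
- exact: card_swap.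
Qed.

End P5free.
End Graphs.

(** * Reduction to boundedly many sizes *)

Section Criterion.
Variables (V : finType) (e : rel V).
Hypotheses (sym_e : symmetric e) (irr_e : irreflexive e).
Hypothesis conn : forall x y, connect e x y.
Let G := SGraph e.

Lemma has_neighbour x y : x != y -> exists z, e x z.
Proof.
move=> xy; have /connectP[[|z p] /=] := conn x y; first by move=> _ E; rewrite E eqxx in xy.
by case/andP=> xz _ _; exists z.
Qed.

Lemma edge_endpoint x y z : e x y -> exists w, e z w.
Proof.
move=> xy; case: (altP (z =P x)) => [->|zx]; first by exists y.
exact: has_neighbour zx.
Qed.

Lemma setT_semitotal x y : e x y -> @semitotal_dom G [set: V].
Proof.
move=> xy; apply/semitotalP; split.
  by apply/dominatingP => z; exists z; rewrite ?inE // /near eqxx.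
move=> z _; have [w zw] := edge_endpoint z xy.
by exists w; rewrite ?inE //; apply: edge_within2.
Qed.

Lemma inducedP5_uniq a b c d f : inducedP5 e a b c d f -> uniq [:: a; b; c; d; f].
Proof.
case=> -[ab bc cd df] [[ac ad af bd bf] cf].
have ed x y : e x y -> x != y by apply: contraTneq => ->; rewrite irr_e.
rewrite /= !inE !negb_or (ed _ _ ab) (ed _ _ bc) (ed _ _ cd) (ed _ _ df) /= !andbT.
have -> : a != c by apply: contraNneq ad => ->.
have -> : a != d by apply: contraNneq af => ->.
have -> : a != f by apply: contraNneq ad => ->; rewrite sym_e.
have -> : b != d by apply: contraNneq bf => ->.
have -> : b != f by apply: contraNneq bd => ->; rewrite sym_e.
by have -> : c != f by apply: contraNneq bf => <-.
Qed.

Definition independent (I : {set V}) := [forall x in I, forall y in I, ~~ e x y].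

Lemma independentP (I : {set V}) :
  reflect {in I &, forall x y, ~~ e x y} (independent I).
Proof.
apply: (iffP forallP) => H.
  move=> x y xI yI; have /implyP/(_ xI)/forallP/(_ y) := H x.
  by rewrite yI.
move=> x; apply/implyP => xI; apply/forallP => y; apply/implyP; exact: H.
Qed.

(** By maximality of [I], the path and [I] dominate. Adding the neighbours [nb] gives every vertex
    of [I] a partner, and conversely; path vertices have partners on the path. The total is at most
    5 + 2 |I|. *)
Lemma small_semitotal t a b c d f : Hfree (P5tK1 t) G -> inducedP5 e a b c d f ->
  exists2 D : {set V}, @semitotal_dom G D & #|D| <= 2 * t + 5.
Proof.
move=> free P5; pose p := [:: a; b; c; d; f]; have up := inducedP5_uniq P5.
pose far : {set V} := [set x | ~~ has (near e x) p].
pose P (I : {set V}) := (I \subset far) && independent I.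
have P0 : P set0 by rewrite /P sub0set; apply/independentP => x; rewrite inE.
case: (@arg_maxnP _ set0 P (fun I => #|I|) P0) => I /andP[IR /independentP indI] maxI.
have farP x y : x \in I -> y \in p -> ~~ near e x y.
  by move=> /(subsetP IR); rewrite inE => /hasPn H /H.
have cardI : #|I| < t.
  rewrite ltnNge; apply/negP => leI; apply: free.
  (* This order follows the numbering of [P5tK1]: path vertices at indices 0 to 4, then isolated
     vertices. *)
  pose s := p ++ take t (enum I).
  have sI x : x \in take t (enum I) -> x \in I.
    by move/mem_take; rewrite mem_enum.
  have sizeI : size (take t (enum I)) = t.
    by rewrite size_take -cardE; case: ltngtP leI.
  have us : uniq s.
    rewrite cat_uniq up take_uniq ?enum_uniq //= andbT.
    apply/hasPn => x /sI xI; apply/negP => xp.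
    by have := farP x x xI xp; rewrite /near eqxx.
  have szs : size s = 5 + t by rewrite size_cat sizeI.
  have sE (i : nat) : i < 5 -> nth a s i = nth a p i by move=> i5; rewrite nth_cat i5.
  have sR (i : nat) : 5 <= i < 5 + t -> nth a s i \in I.
    move=> /andP[i5 it]; rewrite nth_cat ltnNge i5 /=.
    by apply: sI; apply: mem_nth; rewrite sizeI; lia.
  exists (fun i => nth a s i); split.
    move=> i j /eqP; rewrite nth_uniq ?szs //; [by move/eqP/val_inj | exact: ltn_ord..].
  move=> [i ltI] [j ltj]; rewrite /P5tK1 /=.
  have farE x y : x \in I -> y \in p -> e x y = false /\ e y x = false.
    by move=> xI /(farP _ _ xI); rewrite negb_or sym_e => /andP[_ /negPf].
  case: (ltnP i 5) => i5; case: (ltnP j 5) => j5 /=.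
  - rewrite !sE //; case: P5 => -[ab bc cd df] [[ac ad af bd bf] cf].
    have F x y : ~~ e x y -> e x y = false /\ e y x = false.
      by rewrite (sym_e y) => /negPf.
    have T x y : e x y -> e x y = true /\ e y x = true by rewrite (sym_e y).
    move: (F _ _ ac) (F _ _ ad) (F _ _ af) (F _ _ bd) (F _ _ bf) (F _ _ cf).
    move=> [? ?] [? ?] [? ?] [? ?] [? ?] [? ?].
    move: (T _ _ ab) (T _ _ bc) (T _ _ cd) (T _ _ df) => [? ?] [? ?] [? ?] [? ?].
    by move: i j i5 j5 {ltI ltj} => [|[|[|[|[|i]]]]] [|[|[|[|[|j]]]]].
  - by rewrite sE //; apply: (proj2 (farE _ _ (sR j _) _)); rewrite ?j5 ?mem_nth.
  - by rewrite (sE j) //; apply: (proj1 (farE _ _ (sR i _) _)); rewrite ?i5 ?mem_nth.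
  - by apply: negbTE; apply: indI; apply: sR; rewrite ?i5 ?j5.
(* The default is never taken: the path provides an edge, so by connectivity every vertex has a
   neighbour. *)
pose nb x := odflt x [pick z | e x z].
have nbE x : e x (nb x).
  rewrite /nb; case: pickP => //= H; case: P5 => -[ab _ _ _] _.
  by have [z] := edge_endpoint x ab; rewrite H.
pose D : {set V} := [set x in p] :|: I :|: nb @: I.
have pD x : x \in p -> x \in D by rewrite !inE => ->.
exists D; last first.
  have := (leq_card_setU ([set x in p] :|: I) (nb @: I)).1.
  have := (leq_card_setU [set x in p] I).1; have := leq_imset_card nb I.
  have : #|[set x in p]| <= 5 by rewrite cardsE; apply: leq_trans (card_size _) _.
  by rewrite /D; lia.
apply/semitotalP; split.
  apply/dominatingP => x; case: (boolP (has (near e x) p)) => [/hasP[y yp xy]|xR].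
    by exists y => //; apply: pD.
  case: (boolP [exists y in I, near e x y]) => [/existsP[y /andP[yI xy]]|/existsPn nI].
    by exists y => //; rewrite !inE yI orbT.
  have nx y : y \in I -> ~~ e x y.
    by move=> yI; have := nI y; rewrite yI negb_or => /andP[].
  have xI : x \notin I by have := nI x; rewrite /near eqxx andbT.
  have /maxI : P (x |: I).
    rewrite /P subUset IR sub1set inE xR; apply/independentP => y z.
    rewrite !inE => /orP[/eqP ->|yI] /orP[/eqP ->|zI].
    - by rewrite irr_e.
    - exact: nx.
    - by rewrite sym_e nx.
    - exact: indI.
  by rewrite cardsU1 xI add1n; lia.
have w2 x y : y \in D -> e x y -> exists2 y0, y0 \in D & @within2 G x y0.
  by move=> yD xy; exists y => //; apply: edge_within2.
case: P5 => -[ab bc cd df] _.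
move=> x; rewrite !inE -!orbA => /or4P[/eqP ->|/eqP ->|/eqP ->|/or4P[/eqP ->|/eqP ->|xI|]].
- by apply: w2 ab; apply: pD; rewrite !inE eqxx ?orbT.
- by apply: w2 bc; apply: pD; rewrite !inE eqxx ?orbT.
- by apply: w2 cd; apply: pD; rewrite !inE eqxx ?orbT.
- by apply: w2 df; apply: pD; rewrite !inE eqxx ?orbT.
- by apply: (w2 _ d); [apply: pD; rewrite !inE eqxx ?orbT | rewrite sym_e].
- by apply: w2 (nbE x); rewrite !inE imset_f ?orbT.
- case/imsetP=> y yI ->; apply: (w2 _ y); last by rewrite sym_e.
  by rewrite !inE yI ?orbT.
Qed.

(** If [G] has a set of size at most 2t + 5, the smaller set of a successful contraction has the
    separating size [m]. Otherwise there is no induced P_5 and no set of size two, and any edge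
    makes the answer yes. The clause on edges excludes the single vertex, which has no semitotal
    dominating set at all. *)
Lemma ct_le1_criterion t : Hfree (P5tK1 t) G ->
  ct_gt2_le G 1 <->
  (exists2 m, m < 2 * t + 5 &
     (exists u v, e u v /\
        exists2 D : {set sV (@contract G u v)}, semitotal_dom D & #|D| <= m) /\
     ~ (exists2 D : {set V}, @semitotal_dom G D & #|D| <= m)) \/
  (exists x y, e x y) /\
  ~ (exists2 D : {set V}, @semitotal_dom G D & #|D| <= 2 * t + 5).
Proof.
move=> free; split.
  case=> -[|[|j]] [// _]; first by case=> D [sD /(_ D sD)]; rewrite ltnn.
  case=> u [v [uv [D [sD minD]]]].
  case: (boolP [exists D : {set V}, @semitotal_dom G D && (#|D| <= 2 * t + 5)]).
    case/existsP=> D' /andP[sD' leD']; left; exists #|D|.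
      exact: leq_trans (minD _ sD') leD'.
    split; first by exists u, v; split=> //; exists D.
    by case=> D'' /minD; rewrite ltnNge => /negP.
  move/existsPn => nD; right; split; first by exists u, v.
  by case=> D' sD' leD'; have := nD D'; rewrite sD' leD'.
case=> [[m _ [[u [v [uv [D sD leD]]]] nD]]|[[x [y xy]] nD]].
  exists 1; split=> //; exists u, v; split=> //; exists D; split=> // D' sD'.
  by apply: leq_ltn_trans leD _; rewrite ltnNge; apply/negP => ?; apply: nD; exists D'.
have P5free a b c d f : ~ inducedP5 e a b c d f.
  by move=> /(small_semitotal free).
have card_gt2 (D : {set V}) : @semitotal_dom G D -> 2 < #|D|.
  move=> sD; rewrite ltnNge; apply/negP => leD; apply: nD; exists D => //.
  by apply: leq_trans leD _; lia.
(* Starting from a minimum [D], a set no larger than [D] that loses one vertex by contraction beats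
   every set of [G]. *)
case: (@arg_minnP _ [set: V] (@semitotal_dom G) (fun D => #|D|) (setT_semitotal xy)).
move=> D sD minD.
have [D' [u [v [w [sD' leD' fr]]]]] := friendly_exists sym_e irr_e conn P5free card_gt2 sD.
have uv : e u v by case: fr.
have [D'' sD'' ltD''] := contract_semitotal irr_e uv fr sD'.
exists 1; split=> //; exists u, v; split=> //; exists D''; split=> // E sE.
by apply: leq_trans ltD'' (leq_trans leD' _); apply: minD.
Qed.
End Criterion.

(** * Structured programs for one-tape Turing machines *)

(* Cells are addressed by integers increasing to the left of the tape. *)
Definition tape : Type := (Z -> tsym) * Z.

Definition offset (d : tdir) : Z :=
  match d with TLeft => 1%Z | TRight => (-1)%Z | TStay => 0%Z end.

Definition upd (f : Z -> tsym) (z : Z) (s : tsym) : Z -> tsym :=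
  fun a => if Z.eqb a z then s else f a.

Inductive prog :=
| Skip
| Move of tdir
| Write of tsym
| Seq of prog & prog
| If of pred tsym & prog & prog
| While of pred tsym & prog.

(** The counts are exact for the code produced by [trans]: a taken [If] pays for the test and for
    the jump over the other branch, an iteration of [While] for the test and the jump back, a failed
    test for itself only. *)
Inductive exec : prog -> tape -> nat -> tape -> Prop :=
| ExSkip c : exec Skip c 0 c
| ExMove d f z : exec (Move d) (f, z) 1 (f, (z + offset d)%Z)
| ExWrite s f z : exec (Write s) (f, z) 1 (upd f z s, z)
| ExSeq p q c1 T1 c2 T2 c3 :
    exec p c1 T1 c2 -> exec q c2 T2 c3 -> exec (Seq p q) c1 (T1 + T2) c3
| ExIfT (t : pred tsym) p q f z T c : t (f z) -> exec p (f, z) T c -> exec (If t p q) (f, z) T.+2 c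
| ExIfF (t : pred tsym) p q f z T c :
    ~~ t (f z) -> exec q (f, z) T c -> exec (If t p q) (f, z) T.+1 c
| ExWhileT (t : pred tsym) p f z T1 c1 T2 c2 :
    t (f z) -> exec p (f, z) T1 c1 -> exec (While t p) c1 T2 c2 ->
    exec (While t p) (f, z) (T1 + T2).+2 c2
| ExWhileF (t : pred tsym) p f z : ~~ t (f z) -> exec (While t p) (f, z) 1 (f, z).

Fixpoint psize (p : prog) : nat :=
  match p with
  | Skip => 0
  | Move _ | Write _ => 1
  | Seq p q => psize p + psize q
  | If _ p q => (psize p + psize q).+2
  | While _ p => (psize p).+2
  end.

(* Transition of the code of [p] placed at states [o], ..., [o + psize p - 1];
   it is left through state [o + psize p]. *)
Fixpoint trans (p : prog) (o q : nat) (s : tsym) : nat * tsym * tdir :=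
  match p with
  | Skip => (o, s, TStay)
  | Move d => (o.+1, s, d)
  | Write s' => (o.+1, s', TStay)
  | Seq p1 p2 => if q < o + psize p1 then trans p1 o q s
                 else trans p2 (o + psize p1) q s
  | If t p1 p2 =>
      if q == o then (if t s then o.+1 else o + (psize p1).+2, s, TStay)
      else if q < o.+1 + psize p1 then trans p1 o.+1 q s
      else if q == o.+1 + psize p1 then (o + (psize p1 + psize p2).+2, s, TStay)
      else trans p2 (o + (psize p1).+2) q s
  | While t p1 =>
      if q == o then (if t s then o.+1 else o + (psize p1).+2, s, TStay)
      else if q < o.+1 + psize p1 then trans p1 o.+1 q s
      else (o, s, TStay)
  end.

(** The machine halts exactly when control leaves the code, at state [psize p]. *)
Definition machine (p : prog) : TM :=
  {| tm_nq := psize p;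
     tm_delta := fun q s =>
       if q < psize p then
         let: (q', s', d) := trans p 0 q s in Some (inord q', s', d)
       else None |}.

(** [nth None] pads the finite half-tapes with blanks, as the machine itself does when the head runs
    past their ends. *)
Definition on_tape (M : TM) (c : tape) (k : config M) :=
  [/\ c_head k = c.1 c.2,
      forall i : nat, nth None (c_left k) i = c.1 (c.2 + 1 + Z.of_nat i)%Z &
      forall i : nat, nth None (c_right k) i = c.1 (c.2 - 1 - Z.of_nat i)%Z].

Fixpoint steps (M : TM) (T : nat) (k k' : config M) : Prop :=
  if T is T'.+1 then exists2 k1, tm_step k = Some k1 & steps T' k1 k' else k = k'.

Lemma steps_add M T1 T2 (k1 k2 k3 : config M) :
  steps T1 k1 k2 -> steps T2 k2 k3 -> steps (T1 + T2) k1 k3.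
Proof.
elim: T1 k1 => [k1 -> //|T1 IH k1 [k S1 S2] S3].
by exists k => //; apply: IH S3.
Qed.

Lemma tm_run_steps M T T' (k k' : config M) :
  steps T k k' -> tm_step k' = None -> T <= T' -> tm_run T' k = Some k'.
Proof.
elim: T T' k => [|T IH] [|T'] k //=; [by move=> -> -> | by move=> -> -> |].
by case=> k1 -> S1 halt leT; apply: IH.
Qed.

Lemma step_on_tape (P : prog) (c : tape) (k : config (machine P)) q s d :
  on_tape c k -> c_state k < psize P -> trans P 0 (c_state k) (c.1 c.2) = (q, s, d) ->
  q <= psize P ->
  exists2 k', tm_step k = Some k' &
    c_state k' = q :> nat /\ on_tape (upd c.1 c.2 s, (c.2 + offset d)%Z) k'.
Proof.
case: c k => f z [st l h r] [/= Hh Hl Hr] lt tr leq.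
rewrite /tm_step /= Hh lt tr.
have updE a : (a <> z)%Z -> upd f z s a = f a by rewrite /upd; case: Z.eqb_spec.
have updz a : a = z -> upd f z s a = s by move=> ->; rewrite /upd Z.eqb_refl.
eexists; first by reflexivity.
case: d tr => tr /=.
- case: l Hl => [|a l] Hl; (split; first by rewrite /= inordK); split=> /=.
  + by rewrite updE; [have /= := Hl 0; rewrite ?Z.add_0_r ?Z.sub_0_r => -> | lia].
  + move=> i; rewrite nth_nil updE; last lia.
    by have := Hl i.+1; rewrite nth_nil => ->; congr f; lia.
  + case=> [|i] /=; first by rewrite updz //; lia.
    by rewrite Hr updE; [congr f; lia | lia].
  + by rewrite updE; [rewrite -[LHS]/(nth None (a :: l) 0) Hl; congr f; lia | lia].
  + move=> i; rewrite updE; last lia.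
    by rewrite -[LHS]/(nth None (a :: l) i.+1) Hl; congr f; lia.
  + case=> [|i] /=; first by rewrite updz //; lia.
    by rewrite Hr updE; [congr f; lia | lia].
- case: r Hr => [|a r] Hr; (split; first by rewrite /= inordK); split=> /=.
  + by rewrite updE; [have /= := Hr 0; rewrite ?Z.add_0_r ?Z.sub_0_r => -> | lia].
  + case=> [|i] /=; first by rewrite updz //; lia.
    by rewrite Hl updE; [congr f; lia | lia].
  + move=> i; rewrite nth_nil updE; last lia.
    by have := Hr i.+1; rewrite nth_nil => ->; congr f; lia.
  + by rewrite updE; [rewrite -[LHS]/(nth None (a :: r) 0) Hr; congr f; lia | lia].
  + case=> [|i] /=; first by rewrite updz //; lia.
    by rewrite Hl updE; [congr f; lia | lia].
  + move=> i; rewrite updE; last lia.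
    by rewrite -[LHS]/(nth None (a :: r) i.+1) Hr; congr f; lia.
- split; first by rewrite inordK.
  split=> /=; first by rewrite updz //; lia.
  + by move=> i; rewrite Hl updE ?Z.add_0_r //; lia.
  + by move=> i; rewrite Hr updE ?Z.add_0_r //; lia.
Qed.

Lemma on_tape_eq M f g z (k : config M) : f =1 g -> on_tape (f, z) k -> on_tape (g, z) k.
Proof. by move=> fg [/= H1 H2 H3]; split=> [|i|i] /=; rewrite -fg. Qed.

Lemma upd_id f z : upd f z (f z) =1 f.
Proof. by move=> a; rewrite /upd; case: Z.eqb_spec => // ->. Qed.

Lemma jump_on_tape (P : prog) (c : tape) (k : config (machine P)) q :
  on_tape c k -> c_state k < psize P ->
  trans P 0 (c_state k) (c.1 c.2) = (q, c.1 c.2, TStay) -> q <= psize P ->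
  exists2 k', tm_step k = Some k' & c_state k' = q :> nat /\ on_tape c k'.
Proof.
move=> ck lt tr leq; have [k' S' [st' ck']] := step_on_tape ck lt tr leq.
exists k' => //; split=> //; case: c ck' {ck tr} => f z /= ck'.
by apply: on_tape_eq (upd_id f z) _; rewrite /= Z.add_0_r in ck'.
Qed.

Lemma exec_steps p c T c' : exec p c T c' ->
  forall (P : prog) o,
    (forall q s, o <= q < o + psize p -> trans P 0 q s = trans p o q s) ->
    o + psize p <= psize P ->
  forall k : config (machine P), on_tape c k -> c_state k = o :> nat ->
  exists2 k', steps T k k' & c_state k' = o + psize p :> nat /\ on_tape c' k'.
Proof.
elim=> {p c T c'}.
- by move=> c P o tr le k ck st; exists k; rewrite //= addn0.
- move=> d f z P o tr le k ck st.
  have [|||k' S' [st' ck']] := step_on_tape (q := o.+1) (s := f z) (d := d) ck.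
  + by rewrite st; move: le => /=; lia.
  + by rewrite tr st //=; lia.
  + by move: le => /=; lia.
  exists k'; first by exists k'.
  by rewrite st' addn1; split=> //; apply: on_tape_eq (upd_id f z) _.
- move=> s f z P o tr le k ck st.
  have [|||k' S' [st' ck']] := step_on_tape (q := o.+1) (s := s) (d := TStay) ck.
  + by rewrite st; move: le => /=; lia.
  + by rewrite tr st //=; lia.
  + by move: le => /=; lia.
  exists k'; first by exists k'.
  by rewrite st' addn1; split=> //; rewrite /= Z.add_0_r in ck'.
- move=> p q c1 T1 c2 T2 c3 _ IH1 _ IH2 P o /= tr le k ck st.
  have [||k1 S1 [st1 ck1]] := IH1 P o _ _ k ck st.
  + by move=> r s Hr; rewrite tr; [case: ltnP => //; lia | lia].
  + lia.
  have [||k2 S2 [st2 ck2]] := IH2 P (o + psize p) _ _ k1 ck1 st1.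
  + by move=> r s Hr; rewrite tr; [case: ltnP => //; lia | lia].
  + lia.
  by exists k2; [apply: steps_add S1 S2 | rewrite addnA].
- move=> t p q f z T c ts _ IH P o /= tr le k ck st.
  have [|||k1 S1 [st1 ck1]] := jump_on_tape (q := o.+1) ck.
  + by rewrite st; lia.
  + by rewrite tr st /= ?eqxx ?ts //; lia.
  + lia.
  have [||k2 S2 [st2 ck2]] := IH P o.+1 _ _ k1 ck1 st1.
  + by move=> r s Hr; rewrite tr; [do 2 (case: ifP; try lia) | lia].
  + lia.
  have [|||k3 S3 [st3 ck3]] := jump_on_tape (q := o + (psize p + psize q).+2) ck2.
  + by rewrite st2; lia.
  + by rewrite tr st2; [do 3 (case: ifP; try lia) | lia].
  + lia.
  exists k3; last by [].
  change (steps T.+2 k k3); rewrite -addn1; apply: (@steps_add _ T.+1 1 _ k2); last by exists k3.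
  by exists k1.
- move=> t p q f z T c ts _ IH P o /= tr le k ck st.
  have [|||k1 S1 [st1 ck1]] := jump_on_tape (q := o + (psize p).+2) ck.
  + by rewrite st; lia.
  + by rewrite tr st /= ?eqxx ?(negPf ts) //; lia.
  + lia.
  have [||k2 S2 [st2 ck2]] := IH P (o + (psize p).+2) _ _ k1 ck1 st1.
  + by move=> r s Hr; rewrite tr; [do 3 (case: ifP; try lia) | lia].
  + lia.
  exists k2; first by exists k1.
  by rewrite st2; split=> //; lia.
- move=> t p f z T1 c1 T2 c2 ts _ IH1 _ IH2 P o /= tr le k ck st.
  have [|||k1 S1 [st1 ck1]] := jump_on_tape (q := o.+1) ck.
  + by rewrite st; lia.
  + by rewrite tr st /= ?eqxx ?ts //; lia.
  + lia.
  have [||k2 S2 [st2 ck2]] := IH1 P o.+1 _ _ k1 ck1 st1.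
  + by move=> r s Hr; rewrite tr; [do 2 (case: ifP; try lia) | lia].
  + lia.
  have [|||k3 S3 [st3 ck3]] := jump_on_tape (q := o) ck2.
  + by rewrite st2; lia.
  + by rewrite tr st2; [do 2 (case: ifP; try lia) | lia].
  + lia.
  have [k4 S4 ck4] := IH2 P o tr le k3 ck3 st3.
  exists k4; last by [].
  change (steps (T1 + T2).+2 k k4); rewrite -addSn -addnS.
  apply: (@steps_add _ T1.+1 T2.+1 _ k2); first by exists k1.
  by exists k3.
- move=> t p f z ts P o /= tr le k ck st.
  have [|||k1 S1 [st1 ck1]] := jump_on_tape (q := o + (psize p).+2) ck.
  + by rewrite st; lia.
  + by rewrite tr st /= ?eqxx ?(negPf ts) //; lia.
  + lia.
  by exists k1; first by exists k1.
Qed.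

(** The input occupies address 0 and the negative ones; the positive addresses are left free for the
    blocks. *)
Definition input_tape (w : seq bool) : tape :=
  (fun a => if (a <=? 0)%Z then nth None (map Some w) (Z.to_nat (- a)) else None, 0%Z).

Lemma machine_decides p w T c T' : exec p (input_tape w) T c -> T <= T' ->
  tm_decides_in (machine p) w T' (c.1 c.2 == Some true).
Proof.
move=> pT leT.
have [||||k S1 [st [hd _ _]]] :=
    exec_steps pT (P := p) (o := 0) _ _ (k := tm_init (machine p) w).
- by move=> q s _.
- by [].
- case: w {pT} => [|b w]; split=> // i;
    rewrite ?[c_left _]/= ?[c_right _]/= ?nth_nil /input_tape /fst /snd;
    case: Z.leb_spec => Hi //; rewrite ?nth_nil //; try lia.
  by rewrite (_ : Z.to_nat _ = i.+1) //; lia.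
- by case: w {pT}.
exists k; split; last by rewrite hd.
by apply: (tm_run_steps S1) => //; rewrite /tm_step /= st add0n ltnn.
Qed.

Definition runs (p : prog) (c : tape) (B : nat) (c' : tape) :=
  exists2 T, exec p c T c' & T <= B.

Lemma runs_seq p q c1 c2 c3 B1 B2 B : runs p c1 B1 c2 -> runs q c2 B2 c3 ->
  B1 + B2 <= B -> runs (Seq p q) c1 B c3.
Proof.
move=> [T1 E1 le1] [T2 E2 le2] le; exists (T1 + T2); first exact: ExSeq E1 E2.
by lia.
Qed.

Lemma runs_le p c c' B B' : runs p c B c' -> B <= B' -> runs p c B' c'.
Proof. by move=> [T E le] le'; exists T => //; apply: leq_trans le le'. Qed.

Lemma runs_skip c : runs Skip c 0 c.
Proof. by exists 0 => //; constructor. Qed.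

Lemma runs_move d f z z' : z' = (z + offset d)%Z -> runs (Move d) (f, z) 1 (f, z').
Proof. by move=> ->; exists 1 => //; constructor. Qed.

Lemma runs_write s f z : runs (Write s) (f, z) 1 (upd f z s, z).
Proof. by exists 1 => //; constructor. Qed.

Lemma runs_if (t : pred tsym) p q f z B c :
  runs (if t (f z) then p else q) (f, z) B c -> runs (If t p q) (f, z) B.+2 c.
Proof.
case: ifP => ts [T E le]; [exists T.+2 | exists T.+1]; rewrite ?ltnS // 1?ltnW //.
- exact: ExIfT.
- by apply: ExIfF; rewrite ?ts.
Qed.

Lemma runs_while_end (t : pred tsym) p f z : ~~ t (f z) -> runs (While t p) (f, z) 1 (f, z).
Proof. by exists 1 => //; apply: ExWhileF. Qed.

Lemma runs_while (t : pred tsym) p f z c B1 B2 c' : t (f z) ->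
  runs p (f, z) B1 c -> runs (While t p) c B2 c' -> runs (While t p) (f, z) (B1 + B2).+2 c'.
Proof.
move=> ts [T1 E1 le1] [T2 E2 le2]; exists (T1 + T2).+2; first exact: ExWhileT E1 E2.
by lia.
Qed.

Fixpoint moves (d : tdir) (m : nat) : prog :=
  if m is m'.+1 then Seq (Move d) (moves d m') else Skip.

Lemma runs_moves d m f z z' : z' = (z + Z.of_nat m * offset d)%Z ->
  runs (moves d m) (f, z) m (f, z').
Proof.
elim: m z => [|m IH] z Ez /=.
  by rewrite Ez Z.add_0_r; apply: runs_skip.
apply: (runs_seq (B1 := 1) (B2 := m)) => //; first by apply: runs_move.
by apply: IH; rewrite Ez; lia.
Qed.

(** With the block width as stride, the scan visits the same cell of successive blocks, that is, the
    track of one register. *)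
Definition scan (t : pred tsym) (d : tdir) (m : nat) := While t (moves d m).

Lemma runs_scan (t : pred tsym) d m k f z z' :
  (forall i, i < k -> t (f (z + Z.of_nat (i * m) * offset d)%Z)) ->
  ~~ t (f z') -> z' = (z + Z.of_nat (k * m) * offset d)%Z ->
  runs (scan t d m) (f, z) (k * m.+2).+1 (f, z').
Proof.
elim: k z => [|k IH] z tk tz Ez.
  rewrite mul0n; have -> : z = z' by lia.
  by apply: runs_while_end.
apply: (runs_le (B := (m + (k * m.+2).+1).+2)); last by lia.
apply: (runs_while (c := (f, (z + Z.of_nat m * offset d)%Z))).
- by have := tk 0 isT; rewrite mul0n Z.add_0_r.
- exact: runs_moves.
apply: IH => // [i lti|]; last by rewrite Ez; lia.
have := tk i.+1 lti; congr (is_true (t (f _))); lia.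
Qed.

Fixpoint write_cells (l : seq tsym) : prog :=
  if l is s :: l' then Seq (Write s) (Seq (Move TLeft) (write_cells l')) else Skip.

Lemma runs_write_cells l f z z' : z' = (z + Z.of_nat (size l))%Z ->
  exists2 f', runs (write_cells l) (f, z) (2 * size l) (f', z') &
    (forall i, i < size l -> f' (z + Z.of_nat i)%Z = nth None l i) /\
    (forall a, (a < z \/ z' <= a)%Z -> f' a = f a).
Proof.
elim: l f z => [|s l IH] f z Ez /=.
  exists f; last by split.
  by have -> : z' = z by [move: Ez => /=; lia]; apply: runs_skip.
have [|f' R [H1 H2]] := IH (upd f z s) (z + 1)%Z; first by move: Ez => /=; lia.
exists f'.
  have R1 := runs_seq (runs_move (d := TLeft) _ (erefl _)) R (leqnn _).
  by apply: (runs_seq (runs_write _ _ _) R1); lia.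
split=> [[|i] lti /=|a Ha].
- rewrite H2 ?Z.add_0_r /upd ?Z.eqb_refl //; lia.
- by rewrite -H1 //; congr f'; lia.
- rewrite H2; last by move: Ez Ha => /=; lia.
  by rewrite /upd; case: Z.eqb_spec => // E; move: Ez Ha => /=; lia.
Qed.

Definition blank : pred tsym := fun s => s == None.
Definition marked : pred tsym := fun s => s != None.
Definition is0 : pred tsym := fun s => s == Some false.
Definition is1 : pred tsym := fun s => s == Some true.

(** * Register programs with bounded loops *)

Inductive cmd :=
| CSkip
| CZero of nat
| CInc of nat
| CSeq of cmd & cmd
| CIfLe of nat & nat & cmd & cmd
| CIfBit of nat & cmd & cmd
| CFor of nat & cmd.

Definition setr (s : nat -> nat) (r v : nat) : nat -> nat :=
  fun x => if x == r then v else s x.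

(* Registers hold values up to [N = size w]; incrementation saturates. *)
Fixpoint crun (w : seq bool) (c : cmd) (s : nat -> nat) : nat -> nat :=
  match c with
  | CSkip => s
  | CZero r => setr s r 0
  | CInc r => setr s r (minn (size w) (s r).+1)
  | CSeq a b => crun w b (crun w a s)
  | CIfLe x y a b => if s x <= s y then crun w a s else crun w b s
  | CIfBit x a b => if nth false w (s x) then crun w a s else crun w b s
  | CFor r a => foldl (fun s v => crun w a (setr s r v)) s (iota 0 (size w).+1)
  end.

Fixpoint writes (c : cmd) (x : nat) : bool :=
  match c with
  | CSkip => false
  | CZero r | CInc r => x == r
  | CSeq a b | CIfLe _ _ a b | CIfBit _ a b => writes a x || writes b x
  | CFor r a => (x == r) || writes a x
  end.

Fixpoint uses_below (K : nat) (c : cmd) : bool :=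
  match c with
  | CSkip => true
  | CZero r | CInc r => 0 < r < K
  | CSeq a b => uses_below K a && uses_below K b
  | CIfLe x y a b => [&& 0 < x < K, 0 < y < K, uses_below K a & uses_below K b]
  | CIfBit x a b => [&& 0 < x < K, uses_below K a & uses_below K b]
  | CFor r a => (0 < r < K) && uses_below K a
  end.

(** A loop variable that the body leaves alone can itself serve as the counter of the compiled
    loop. *)
Fixpoint loops_ok (c : cmd) : bool :=
  match c with
  | CSkip | CZero _ | CInc _ => true
  | CSeq a b | CIfLe _ _ a b | CIfBit _ a b => loops_ok a && loops_ok b
  | CFor r a => ~~ writes a r && loops_ok a
  end.

Lemma setr_neq s r v x : x != r -> setr s r v x = s x.
Proof. by rewrite /setr => /negPf ->. Qed.

Lemma setr_eq s r v : setr s r v r = v.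
Proof. by rewrite /setr eqxx. Qed.

Lemma foldl_ind (T U : Type) (P : T -> Prop) (F : T -> U -> T) s l :
  (forall s v, P s -> P (F s v)) -> P s -> P (foldl F s l).
Proof. by move=> FP; elim: l s => //= v l IH s /(FP _ v)/IH. Qed.

Lemma crun_frame w c s x : ~~ writes c x -> crun w c s x = s x.
Proof.
elim: c s => [|r|r|a IHa b IHb|y z a IHa b IHb|y a IHa b IHb|r a IHa] s //=.
- exact: setr_neq.
- exact: setr_neq.
- by rewrite negb_or => /andP[/IHa Ea /IHb Eb]; rewrite Eb Ea.
- by rewrite negb_or => /andP[/IHa Ea /IHb Eb]; case: ifP.
- by rewrite negb_or => /andP[/IHa Ea /IHb Eb]; case: ifP.
- rewrite negb_or => /andP[xr /IHa Ea].
  apply: (@foldl_ind _ _ (fun s' => s' x = s x) _ _ (iota 0 (size w).+1)) => // s' v Es.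
  by rewrite Ea setr_neq.
Qed.

(** * Compilation of register programs *)

Section Layout.
Variables (w : seq bool) (K : nat).
Hypothesis K_gt0 : 0 < K.
Let N := size w.
(** One block more than the [N.+1] filled ones, because the head steps into the blank block behind
    them to notice the end. *)
Let S := (N + 2) * K.

Definition addr (i j : nat) : Z := (1 + Z.of_nat (i * K + j))%Z.

(** A register is a single mark on its own track, in the block numbered by its value; the input bit
    with that index is cell 0 of the same block. *)
Definition cell (s : nat -> nat) (i j : nat) : bool :=
  if j == 0 then nth false w i else s j == i.

(* The first [m] blocks of [K] cells, starting at address 1, contain the input bit
   of their index followed by the unary registers. *)
Definition filled (m : nat) (s : nat -> nat) (f : Z -> tsym) :=
  [/\ f 0%Z = None,
      forall i j, i < m -> j < K -> f (addr i j) = Some (cell s i j) &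
      forall a, (Z.of_nat (m * K) < a)%Z -> f a = None].

Definition holds (s : nat -> nat) (f : Z -> tsym) :=
  filled N.+1 s f /\ forall r, s r <= N.

Lemma addr_inj i j i' j' : j < K -> j' < K -> addr i j = addr i' j' -> i = i' /\ j = j'.
Proof.
move=> jK j'K E; have {}E : i * K + j = i' * K + j' by move: E; rewrite /addr; lia.
have Ei : i = i'.
  have := congr1 (divn^~ K) E; rewrite /= !divnMDl // !divn_small //.
  by rewrite !addn0.
by split=> //; move: E; rewrite Ei; lia.
Qed.

(** All that returning to address 1 relies on: where the blanks are, not what the other cells
    contain. *)
Definition shape (m : nat) (f : Z -> tsym) :=
  [/\ f 0%Z = None,
      forall a, (0 < a <= Z.of_nat (m * K))%Z -> marked (f a) &
      forall a, (Z.of_nat (m * K) < a)%Z -> f a = None].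

Lemma filled_shape m s f : filled m s f -> shape m f.
Proof.
move=> [f0 H fT]; split=> // a Ha; have := divn_eq (Z.to_nat (a - 1)) K => Eq.
have lt := ltn_pmod (Z.to_nat (a - 1)) K_gt0.
have -> : a = addr (Z.to_nat (a - 1) %/ K) (Z.to_nat (a - 1) %% K) by rewrite /addr; lia.
rewrite H //; by nia.
Qed.

Lemma shape_upd m f i j b : shape m f -> i < m -> j < K ->
  shape m (upd f (addr i j) (Some b)).
Proof.
move=> [f0 fM fT] im jK; have : (0 < addr i j <= Z.of_nat (m * K))%Z by rewrite /addr; nia.
move=> Ha; split=> [|a Ia|a Ia]; rewrite /upd; case: Z.eqb_spec => // E;
  [lia | exact: fM | lia | exact: fT].
Qed.

Lemma S_gt0 : 0 < S. Proof. by rewrite /S; nia. Qed.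
Lemma SE : S = N * K + 2 * K. Proof. by rewrite /S; nia. Qed.
Lemma addr_gt0 i j : (0 < addr i j)%Z. Proof. by rewrite /addr; lia. Qed.
Lemma addr_le i j : i <= N.+1 -> j < K -> (addr i j <= Z.of_nat S)%Z.
Proof. by move=> iN jK; rewrite /addr SE; nia. Qed.
Lemma K_le : K <= S. Proof. by rewrite SE; nia. Qed.

(** The first scan matters only if the head is beyond the last block; the second stops on the
    separator at address 0. *)
Definition home := Seq (scan blank TRight 1) (Seq (scan marked TRight 1) (Move TLeft)).

Lemma runs_home f z : shape N.+1 f -> (0 < z <= Z.of_nat S)%Z ->
  runs home (f, z) (10 * S) (f, 1%Z).
Proof.
move=> [f0 fM fT] Hz; have S0 := S_gt0; have ES := SE.
pose z1 := Z.min z (Z.of_nat (N.+1 * K)).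
have z1_gt0 : (0 < z1)%Z by rewrite /z1; nia.
apply: (runs_seq (c2 := (f, z1)) (B1 := 3 * S + 1) (B2 := 4 * S + 2)); last by lia.
  apply: runs_le (runs_scan (k := Z.to_nat (z - z1)) _ _ _) _.
  - move=> i lti; rewrite /blank fT //; move: lti; rewrite /z1 /=; lia.
  - by apply: (fM z1); rewrite /z1; lia.
  - by rewrite /z1 /=; lia.
  - by rewrite /z1; lia.
apply: (runs_seq (c2 := (f, 0%Z)) (B1 := 3 * S + 1) (B2 := 1)); last by lia.
  apply: runs_le (runs_scan (k := Z.to_nat z1) _ _ _) _.
  - move=> i lti; apply: fM; move: lti; rewrite /z1 /=; lia.
  - by rewrite f0.
  - by rewrite /=; lia.
  - by rewrite /z1; lia.
exact: runs_move.
Qed.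

Lemma runs_home_addr f i j : shape N.+1 f -> i <= N.+1 -> j < K ->
  runs home (f, addr i j) (10 * S) (f, 1%Z).
Proof.
move=> fS iN jK; apply: runs_home => //.
by have := addr_gt0 i j; have := addr_le iN jK; lia.
Qed.

Lemma runs_stride f i j j' d m : ((Z.of_nat j + Z.of_nat m * offset d)%Z = Z.of_nat j') ->
  runs (moves d m) (f, addr i j) m (f, addr i j').
Proof.
by move=> E; apply: runs_moves; rewrite /addr; move: (Z.of_nat m * _)%Z E => z E; lia.
Qed.

Lemma runs_next f i j : runs (moves TLeft K) (f, addr i j) K (f, addr i.+1 j).
Proof. by apply: runs_moves; rewrite /addr /offset; lia. Qed.

Lemma runs_prev f i j : runs (moves TRight K) (f, addr i.+1 j) K (f, addr i j).
Proof. by apply: runs_moves; rewrite /addr /offset; lia. Qed.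

Lemma runs_track f j : runs (moves TLeft j) (f, 1%Z) j (f, addr 0 j).
Proof. by apply: runs_moves; rewrite /addr /offset; lia. Qed.

Lemma runs_skip0 f i i' j : i <= i' -> i' <= N.+1 ->
  (forall x, i <= x < i' -> f (addr x j) = Some false) -> f (addr i' j) <> Some false ->
  runs (scan is0 TLeft K) (f, addr i j) (4 * S) (f, addr i' j).
Proof.
move=> ii' iN f0 f1; have ES := SE; apply: runs_le (runs_scan (k := i' - i) _ _ _) _.
- move=> x ltx; rewrite /is0.
  have -> : (addr i j + Z.of_nat (x * K) * offset TLeft)%Z = addr (x + i) j.
    by rewrite /addr /offset; lia.
  by rewrite f0 //; lia.
- exact/eqP.
- by rewrite /addr /offset; nia.
- by nia.
Qed.

Definition find r := Seq (moves TLeft r) (scan is0 TLeft K).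

Lemma runs_find s f r : holds s f -> 0 < r < K ->
  runs (find r) (f, 1%Z) (5 * S) (f, addr (s r) r).
Proof.
move=> [[f0 fC fT] sN] /andP[r0 rK]; have Kle := K_le.
have cE i : i <= N -> f (addr i r) = Some (s r == i).
  by move=> iN; rewrite fC // /cell; case: eqP => // E; rewrite E in r0.
apply: (runs_seq (B1 := S) (B2 := 4 * S) (c2 := (f, addr 0 r))); last by lia.
- by apply: runs_le (runs_track _ _) _; lia.
- apply: runs_skip0 => //; first by have := sN r; lia.
  + move=> x /andP[_ lt]; rewrite cE; last by have := sN r; lia.
    by congr Some; apply/eqP; lia.
  + by rewrite cE ?eqxx.
Qed.

(** Shared by reset and increment. The old and the new position may coincide, so the mark is erased
    before it is written. *)
Lemma holds_move s f r v : holds s f -> 0 < r < K -> v <= N ->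
  holds (setr s r v)
        (upd (upd f (addr (s r) r) (Some false)) (addr v r) (Some true)).
Proof.
move=> [[f0 fC fT] sN] /andP[r0 rK] vN.
have rn0 : r == 0 = false by lia.
split; last by move=> x; rewrite /setr; case: ifP.
split=> [|i j iN jK|a Ha].
- by rewrite /upd; do 2 (case: Z.eqb_spec => [E|_]; first by rewrite /addr in E; lia).
- rewrite /upd; case: Z.eqb_spec => [/(addr_inj jK rK)[-> ->]|n1].
    by rewrite /cell rn0 setr_eq eqxx.
  case: Z.eqb_spec => [/(addr_inj jK rK)[Ei Ej]|n2].
    rewrite /cell Ej rn0 setr_eq; congr Some; apply/esym/eqP => Ev.
    by apply: n1; rewrite Ej -Ev.
  rewrite fC // /cell; case: ifP => // j0; congr Some.
  rewrite /setr; case: (altP (j =P r)) => // Ej; rewrite Ej in n1 n2 *.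
  by apply/eqP/eqP => E; [case: n2 | case: n1]; rewrite E.
- have Hv x : x <= N -> a <> addr x r by move=> xN; rewrite /addr; nia.
  rewrite /upd; case: Z.eqb_spec => [E|_]; first by case: (Hv v vN).
  by case: Z.eqb_spec => [E|_]; [case: (Hv (s r) (sN r)) | apply: fT].
Qed.

Definition zero r :=
  Seq (find r) (Seq (Write (Some false)) (Seq home
    (Seq (moves TLeft r) (Seq (Write (Some true)) home)))).

Lemma runs_zero s f r : holds s f -> 0 < r < K ->
  exists2 f', runs (zero r) (f, 1%Z) (40 * S) (f', 1%Z) & holds (setr s r 0) f'.
Proof.
move=> fH rK; have [fF sN] := fH; have [r0 rK'] := andP rK.
have S0 := S_gt0; have Kle := K_le.
have sh := filled_shape fF.
have sh1 : shape N.+1 (upd f (addr (s r) r) (Some false)) by apply: shape_upd; rewrite ?ltnS.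
eexists; last exact: (holds_move fH rK (leq0n _)).
apply: (runs_seq (runs_find fH rK)).
  apply: (runs_seq (runs_write _ _ _)).
    apply: (runs_seq (runs_home_addr sh1 _ rK')); first by apply: leqW.
      apply: (runs_seq (runs_track _ _)).
        apply: (runs_seq (runs_write _ _ _)); last exact: leqnn.
        by apply: (runs_home_addr _ _ rK') => //; apply: shape_upd.
      exact: leqnn.
    exact: leqnn.
  exact: leqnn.
by lia.
Qed.

(** A blank in the block after the mark means that the value is already [N]; the register then
    saturates. *)
Definition inc r :=
  Seq (find r) (Seq (moves TLeft K)
    (If blank home (Seq (moves TRight K) (Seq (Write (Some false))
       (Seq (moves TLeft K) (Seq (Write (Some true)) home)))))).

Lemma shape_blank f j : shape N.+1 f -> f (addr N.+1 j) = None.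
Proof. by case=> _ _; apply; rewrite /addr; nia. Qed.

Lemma shape_marked f i j : shape N.+1 f -> i <= N -> j < K -> marked (f (addr i j)).
Proof. by case=> _ + _ iN jK; apply; rewrite /addr; nia. Qed.

Lemma runs_inc s f r : holds s f -> 0 < r < K ->
  exists2 f', runs (inc r) (f, 1%Z) (40 * S) (f', 1%Z) &
    holds (setr s r (minn N (s r).+1)) f'.
Proof.
move=> fH rK; have [fF sN] := fH; have [r0 rK'] := andP rK.
have S0 := S_gt0; have Kle := K_le.
have sh := filled_shape fF.
have key g : runs (if blank (f (addr (s r).+1 r)) then home else
     (Seq (moves TRight K) (Seq (Write (Some false))
       (Seq (moves TLeft K) (Seq (Write (Some true)) home)))))
   (f, addr (s r).+1 r) (20 * S) (g, 1%Z) -> runs (inc r) (f, 1%Z) (40 * S) (g, 1%Z).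
  move=> R; apply: (runs_seq (runs_find fH rK)).
    apply: (runs_seq (runs_next _ _ _)); last exact: leqnn.
    by apply: runs_if R.
  by lia.
case: (ltnP (s r) N) => [lt|ge].
  have -> : minn N (s r).+1 = (s r).+1 by lia.
  eexists; last exact: (holds_move fH rK lt).
  apply: key.
  have -> : blank (f (addr (s r).+1 r)) = false.
    by apply/negbTE; apply: shape_marked.
  apply: (runs_seq (runs_prev _ _ _)).
    apply: (runs_seq (runs_write _ _ _)); last exact: leqnn.
    apply: (runs_seq (runs_next _ _ _)); last exact: leqnn.
    apply: (runs_seq (runs_write _ _ _)); last exact: leqnn.
    apply: (runs_home_addr _ _ rK'); last by apply: leqW.
    by apply: shape_upd => //; apply: shape_upd => //; apply: leqW.
  by lia.
have Er : s r = N by apply/eqP; rewrite eqn_leq sN.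
have -> : minn N (s r).+1 = s r by lia.
exists f; last first.
  split; last by move=> x; rewrite /setr; case: ifP.
  case: fF => f0 fC fT; split=> // i j iN jK; rewrite fC // /cell; case: ifP => // _.
  by rewrite /setr; case: (altP (j =P r)) => // ->.
apply: key; rewrite Er shape_blank //=.
by apply: runs_le (runs_home_addr sh (leqnn _) rK') _; lia.
Qed.

Definition next r := Seq (find r) (moves TLeft K).

(** For [CIfLe], the head changes from the mark of [x] to the track of [y] in the same block and
    searches upwards: it meets the mark of [y] if that is not below, and a blank otherwise. For
    [CFor], the value 0 is treated before the loop, and [next] then tests whether a further block,
    hence a further value, exists. *)
Fixpoint compile (c : cmd) : prog :=
  match c with
  | CSkip => Skip
  | CZero r => zero r
  | CInc r => inc r
  | CSeq a b => Seq (compile a) (compile b)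
  | CIfLe x y a b =>
      Seq (find x) (Seq (moves TLeft y) (Seq (moves TRight x) (Seq (scan is0 TLeft K)
        (If is1 (Seq home (compile a)) (Seq home (compile b))))))
  | CIfBit x a b =>
      Seq (find x) (Seq (moves TRight x)
        (If is1 (Seq home (compile a)) (Seq home (compile b))))
  | CFor r a =>
      Seq (zero r) (Seq (compile a) (Seq (next r)
        (Seq (While marked (Seq home (Seq (inc r) (Seq (compile a) (next r))))) home)))
  end.

Fixpoint ctime (c : cmd) : nat :=
  match c with
  | CSkip => 0
  | CZero _ | CInc _ => 40 * S
  | CSeq a b => ctime a + ctime b
  | CIfLe _ _ a b | CIfBit _ a b => 40 * S + ctime a + ctime b
  | CFor _ a => N.+2 * (80 * S + ctime a)
  end.

Lemma runs_ifle s f x y p q B c : holds s f -> 0 < x < K -> 0 < y < K ->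
  runs (if s x <= s y then p else q) (f, 1%Z) B c ->
  runs (Seq (find x) (Seq (moves TLeft y) (Seq (moves TRight x) (Seq (scan is0 TLeft K)
        (If is1 (Seq home p) (Seq home q)))))) (f, 1%Z) (40 * S + B) c.
Proof.
move=> fH xK yK R; have [[f0 fC fT] sN] := fH.
have S0 := S_gt0; have Kle := K_le; have sh := filled_shape fH.1.
have [x0 xK'] := andP xK; have [y0 yK'] := andP yK.
have cE i : i <= N -> f (addr i y) = Some (s y == i).
  by move=> iN; rewrite fC // /cell; case: eqP => // E; rewrite E in y0.
(* The block where the search stops: the mark of [y], or the first blank block. *)
pose v := if s x <= s y then s y else N.+1.
have Rscan : runs (scan is0 TLeft K) (f, addr (s x) y) (4 * S) (f, addr v y).
  have := sN x; have := sN y => Hy Hx.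
  rewrite /v; case: leqP => le; apply: runs_skip0 => //; try lia.
  - by move=> i Hi; rewrite cE; [congr Some; apply/eqP; lia | lia].
  - by rewrite cE // eqxx.
  - by move=> i Hi; rewrite cE; [congr Some; apply/eqP; lia | lia].
  - by rewrite shape_blank.
apply: (runs_seq (runs_find fH xK)).
  apply: (runs_seq (c2 := (f, addr (s x) (x + y))) (runs_stride _ _ _)).
  - by rewrite /offset; lia.
  - apply: (runs_seq (c2 := (f, addr (s x) y)) (runs_stride _ _ _)); last exact: leqnn.
      by rewrite /offset; lia.
    apply: (runs_seq Rscan); last exact: leqnn.
    apply: runs_if; rewrite /is1 (_ : (f _ == _) = (s x <= s y)); last first.
      by rewrite /v; case: leqP => le; rewrite ?shape_blank // cE // eqxx.
    instantiate (1 := 10 * S + B).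
    have Rh : runs home (f, addr v y) (10 * S) (f, 1%Z).
      by apply: runs_home_addr => //; rewrite /v; case: ifP => // _; apply: leqW.
    by case: ifP R => _ R; apply: (runs_seq Rh R).
  - exact: leqnn.
by lia.
Qed.

Lemma runs_ifbit s f x p q B c : holds s f -> 0 < x < K ->
  runs (if nth false w (s x) then p else q) (f, 1%Z) B c ->
  runs (Seq (find x) (Seq (moves TRight x)
        (If is1 (Seq home p) (Seq home q)))) (f, 1%Z) (40 * S + B) c.
Proof.
move=> fH xK R; have [[f0 fC fT] sN] := fH.
have S0 := S_gt0; have Kle := K_le; have sh := filled_shape fH.1.
have [x0 xK'] := andP xK.
apply: (runs_seq (runs_find fH xK)).
  apply: (runs_seq (c2 := (f, addr (s x) 0)) (runs_stride _ _ _)).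
  - by rewrite /offset; lia.
  - apply: runs_if; rewrite /is1 fC // ?ltnS // /cell eqxx.
    have -> : (Some (nth false w (s x)) == Some true) = nth false w (s x) by case: (nth _ _ _).
    instantiate (1 := 10 * S + B).
    have Rh : runs home (f, addr (s x) 0) (10 * S) (f, 1%Z).
      by apply: runs_home_addr => //; apply: leqW.
    by case: ifP R => _ R; apply: (runs_seq Rh R).
  - exact: leqnn.
by lia.
Qed.

Lemma runs_next_reg s f r : holds s f -> 0 < r < K ->
  runs (next r) (f, 1%Z) (6 * S) (f, addr (s r).+1 r).
Proof.
move=> fH rK; have Kle := K_le; apply: (runs_seq (runs_find fH rK) (runs_next _ _ _)).
by lia.
Qed.

Lemma compile_correct c s f : uses_below K c -> loops_ok c -> holds s f ->
  exists2 f', runs (compile c) (f, 1%Z) (ctime c) (f', 1%Z) & holds (crun w c s) f'.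
Proof.
have S0 := S_gt0.
elim: c s f => [|r|r|a IHa b IHb|y z a IHa b IHb|y a IHa b IHb|r a IHa] s f.
- by move=> _ _ fH; exists f => //; apply: runs_skip.
- by move=> /= rK _ fH; apply: runs_zero.
- by move=> /= rK _ fH; apply: runs_inc.
- move=> /= /andP[aK bK] /andP[aL bL] fH; have [f1 R1 H1] := IHa s f aK aL fH.
  have [f2 R2 H2] := IHb _ _ bK bL H1.
  by exists f2 => //; apply: runs_seq R1 R2 _.
- move=> /= /and4P[yK zK aK bK] /andP[aL bL] fH.
  have [f1 R1 H1] := IHa s f aK aL fH; have [f2 R2 H2] := IHb s f bK bL fH.
  case: (leqP (s y) (s z)) => le; [exists f1 | exists f2] => //;
    rewrite -addnA; apply: runs_ifle fH yK zK _; rewrite leqNgt ?le ?(ltnNge (s z)) ?le /=.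
  + by apply: runs_le R1 _; lia.
  + by apply: runs_le R2 _; lia.
- move=> /= /and3P[yK aK bK] /andP[aL bL] fH.
  have [f1 R1 H1] := IHa s f aK aL fH; have [f2 R2 H2] := IHb s f bK bL fH.
  case E: (nth _ _ _); [exists f1 | exists f2] => //;
    rewrite -addnA; apply: runs_ifbit fH yK _; rewrite E.
  + by apply: runs_le R1 _; lia.
  + by apply: runs_le R2 _; lia.
rewrite [uses_below _ _]/= [loops_ok _]/= => /andP[rK aK] /andP[ra aL] fH.
have [f1 R1 H1] := runs_zero fH rK.
have [f2 R2 H2] := IHa _ _ aK aL H1.
have E2 : crun w a (setr s r 0) r = 0 by rewrite crun_frame // setr_eq.
pose F s v := crun w a (setr s r v).
(* With [m] values left, the head waits one block past the mark of [r], where it reads a blank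
   exactly when [r] has reached [N]. *)
have loop m g t : holds t g -> t r + m = N ->
  exists2 g', runs (While marked (Seq home (Seq (inc r) (Seq (compile a) (next r)))))
      (g, addr (t r).+1 r) (m * (60 * S + ctime a)).+1 (g', addr N.+1 r) &
    holds (foldl F t (iota (t r).+1 m)) g'.
  elim: m g t => [|m IHm] g t gH Em.
    exists g => //; have -> : t r = N by lia.
    by apply: runs_while_end; rewrite shape_blank //; apply: filled_shape gH.1.
  have sh := filled_shape gH.1; have [r0 rK'] := andP rK.
  have [g1 Q1 G1] := runs_inc gH rK.
  have [g2 Q2 G2] := IHa _ _ aK aL G1.
  have Ei : minn N (t r).+1 = (t r).+1 by lia.
  have Et : crun w a (setr t r (t r).+1) r = (t r).+1 by rewrite crun_frame // setr_eq.
  rewrite Ei in G2.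
  have Q3 := runs_next_reg G2 rK.
  have [|g3 Q4 G3] := IHm _ _ G2; first by rewrite Et; lia.
  exists g3; last by rewrite /= -[X in iota X.+1 m]Et.
  have Q0 : runs home (g, addr (t r).+1 r) (10 * S) (g, 1%Z).
    by apply: runs_home_addr => //; lia.
  have Q := runs_seq Q0 (runs_seq Q1 (runs_seq Q2 Q3 (leqnn _)) (leqnn _)) (leqnn _).
  apply: runs_le (runs_while _ Q Q4) _; last by lia.
  by apply: shape_marked => //; lia.
have [|f3 R3 H3] := loop N f2 _ H2; first by rewrite E2.
exists f3; last by rewrite /= -/F; rewrite E2 in H3.
have Q := runs_next_reg H2 rK.
have Qh : runs home (f3, addr N.+1 r) (10 * S) (f3, 1%Z).
  by apply: runs_home_addr => //; [apply: filled_shape H3.1 | case/andP: rK].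
rewrite /=.
apply: (runs_seq R1 (runs_seq R2 (runs_seq Q (runs_seq R3 Qh (leqnn _)) (leqnn _)) (leqnn _))).
by lia.
Qed.
End Layout.

Lemma ctime_poly K c : exists A k, forall w, ctime w K c <= A * (size w).+1 ^ k.
Proof.
have add A1 k1 A2 k2 n : A1 * n.+1 ^ k1 + A2 * n.+1 ^ k2 <= (A1 + A2) * n.+1 ^ (k1 + k2).
  rewrite mulnDl; apply: leq_add; rewrite leq_mul2l; apply/orP; right.
    by apply: leq_pexp2l; rewrite // leq_addr.
  by apply: leq_pexp2l; rewrite // leq_addl.
have prim : forall n, 80 * ((n + 2) * K) <= (160 * K) * n.+1 ^ 1 by move=> n; rewrite expn1; nia.
have prim' n : 40 * ((n + 2) * K) <= (160 * K) * n.+1 ^ 1 by apply: leq_trans (prim n); lia.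
elim: c => [|r|r|a [A1 [k1 H1]] b [A2 [k2 H2]]|y z a [A1 [k1 H1]] b [A2 [k2 H2]]
           |y a [A1 [k1 H1]] b [A2 [k2 H2]]|r a [A1 [k1 H1]]].
- by exists 0, 0.
- by exists (160 * K), 1 => w; apply: prim'.
- by exists (160 * K), 1 => w; apply: prim'.
- exists (A1 + A2), (k1 + k2) => w; apply: leq_trans (add _ _ _ _ _).
  exact: leq_add (H1 w) (H2 w).
- exists (160 * K + A1 + A2), (1 + k1 + k2) => w; apply: leq_trans (add _ _ _ _ _).
  exact: leq_add (leq_trans (leq_add (prim' _) (H1 w)) (add _ _ _ _ _)) (H2 w).
- exists (160 * K + A1 + A2), (1 + k1 + k2) => w; apply: leq_trans (add _ _ _ _ _).
  exact: leq_add (leq_trans (leq_add (prim' _) (H1 w)) (add _ _ _ _ _)) (H2 w).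
exists (2 * (160 * K + A1)), (1 + k1).+1 => w /=.
rewrite expnS mulnACA; apply: leq_mul; first by lia.
exact: leq_trans (leq_add (prim _) (H1 w)) (add _ _ _ _ _).
Qed.

(** * Laying out the input in blocks *)

Section Prepare.
Variables (w : seq bool) (K : nat).
Hypothesis K_gt0 : 0 < K.
Let N := size w.
Let S := (N + 2) * K.

(** The blank put in place of the bit marks the place to return to. The bit is restored afterwards,
    because later copies scan across this cell to reach the separator. *)
Definition copy_bit (b : bool) :=
  Seq (Write None) (Seq (Move TLeft) (Seq (scan marked TLeft 1) (Seq (Move TLeft)
  (Seq (scan marked TLeft 1) (Seq (write_cells (Some b :: nseq K.-1 (Some false)))
  (Seq (Move TRight) (Seq (scan marked TRight 1) (Seq (Move TRight)
  (Seq (scan marked TRight 1) (Seq (Write (Some b)) (Move TRight))))))))))).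

(** All registers start at 0, so their marks are all in block 0; every later block gets unmarked
    register cells. *)
Definition first_bit (b : bool) :=
  Seq (Write None) (Seq (Move TLeft) (Seq (write_cells (Some b :: nseq K.-1 (Some true)))
  (Seq (Move TRight) (Seq (scan marked TRight 1) (Move TRight))))).

(** Block [N] has no input bit but represents the register value [N]; its bit cell holds false, the
    default of [nth]. *)
Definition last_block :=
  Seq (Move TLeft) (Seq (scan marked TLeft 1) (Seq (Move TLeft)
  (Seq (scan marked TLeft 1) (Seq (write_cells (nseq K (Some false)))
  (Seq (Move TRight) (Seq (scan marked TRight 1) (Move TLeft))))))).

(* Moves the input, bit by bit, into blocks to its left; the cell of the first bit
   becomes the blank separator. *)
Definition prepare :=
  Seq (If is1 (first_bit true) (first_bit false))
  (Seq (While marked (If is1 (copy_bit true) (copy_bit false))) last_block).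

Definition zeros : nat -> nat := fun _ => 0.

Definition copied (m : nat) (f : Z -> tsym) :=
  filled w K m zeros f /\
  forall i : nat, 0 < i -> f (- Z.of_nat i)%Z = nth None (map Some w) i.

Lemma runs_scan_up f z z' B : (z <= z')%Z -> (forall a, (z <= a < z')%Z -> marked (f a)) ->
  f z' = None -> 3 * Z.to_nat (z' - z) + 1 <= B -> runs (scan marked TLeft 1) (f, z) B (f, z').
Proof.
move=> le H E leB; apply: runs_le (runs_scan (k := Z.to_nat (z' - z)) _ _ _) _.
- by move=> i lti; apply: H; rewrite /offset; lia.
- by rewrite E.
- by rewrite /offset; lia.
- by lia.
Qed.

Lemma runs_scan_down f z z' B : (z' <= z)%Z -> (forall a, (z' < a <= z)%Z -> marked (f a)) ->
  f z' = None -> 3 * Z.to_nat (z - z') + 1 <= B -> runs (scan marked TRight 1) (f, z) B (f, z').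
Proof.
move=> le H E leB; apply: runs_le (runs_scan (k := Z.to_nat (z - z')) _ _ _) _.
- by move=> i lti; apply: H; rewrite /offset; lia.
- by rewrite E.
- by rewrite /offset; lia.
- by lia.
Qed.

Lemma filled_block m f f' b c :
  filled w K m zeros f -> m <= N -> b = nth false w m -> c = (m == 0) ->
  (forall i, i < K -> f' (Z.of_nat (m * K) + 1 + Z.of_nat i)%Z =
      nth None (Some b :: nseq K.-1 (Some c)) i) ->
  (forall a, (0 <= a < Z.of_nat (m * K) + 1 \/ Z.of_nat (m * K) + 1 + Z.of_nat K <= a)%Z ->
     f' a = f a) ->
  filled w K m.+1 zeros f'.
Proof.
move=> [f0 fC fT] mN Eb Ec f'K f'O; split=> [|i j|a Ha].
- by rewrite f'O //; lia.
- rewrite ltnS leq_eqVlt => /orP[/eqP -> jK|ltm jK]; last first.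
    by rewrite f'O ?fC // /addr; left; nia.
  rewrite (_ : addr K m j = Z.of_nat (m * K) + 1 + Z.of_nat j)%Z; last by rewrite /addr; lia.
  rewrite f'K // /cell; case: j jK => [|j] jK /=; first by rewrite Eb.
  by rewrite nth_nseq; case: ltnP => [_|]; [rewrite Ec eq_sym | lia].
- by rewrite f'O ?fT //; right || idtac; nia.
Qed.

Lemma nth_marked i : i < N -> marked (nth None (map Some w) i).
Proof. by move=> iN; rewrite (nth_map false). Qed.

Lemma runs_first f z : f = (input_tape w).1 -> z = 0%Z -> 0 < N ->
  exists2 f', runs (If is1 (first_bit true) (first_bit false)) (f, z) (20 * S) (f', (-1)%Z) &
    copied 1 f'.
Proof.
move=> Ef -> N0; have S0 := S_gt0 w K_gt0; have KS := K_le w K_gt0.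
pose b := nth false w 0.
have fb : f 0%Z = Some b by rewrite Ef /= (nth_map false).
pose f1 := upd f 0 None.
have sz c : size (Some b :: nseq K.-1 (Some c)) = K by rewrite /= size_nseq prednK.
have [|f2 R2 [H1 H2]] :=
    @runs_write_cells (Some b :: nseq K.-1 (Some true)) f1 1%Z (1 + Z.of_nat K)%Z.
  by rewrite sz.
rewrite sz in R2 H1.
have fT a : (0 < a)%Z -> f a = None by rewrite Ef /=; case: Z.leb_spec => //; lia.
have fil : filled w K 1 zeros f2.
  apply: (filled_block (m := 0) (f := f1) (b := b) (c := true)) => //.
  - split=> // a Ha; rewrite /f1 /upd; case: Z.eqb_spec => // _; apply: fT; lia.
  - by move=> a Ha; apply: H2; lia.
have [g0 gM gT] := filled_shape K_gt0 fil.
exists f2; last first.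
  split=> // i i0; rewrite H2; last lia.
  rewrite /f1 /upd; case: Z.eqb_spec => [|_]; first by lia.
  rewrite Ef /=; case: Z.leb_spec => ?; last lia.
  by congr nth; lia.
apply: (runs_le (B := (19 * S - 2).+2)); last by lia.
apply: runs_if.
have -> : (if is1 (f 0%Z) then first_bit true else first_bit false) = first_bit b.
  by rewrite fb /is1; case: (b).
apply: (runs_seq (runs_write _ _ _)).
  apply: (runs_seq (runs_move (d := TLeft) _ (erefl _))).
    apply: (runs_seq R2).
      apply: (runs_seq (c2 := (f2, Z.of_nat K))); first by apply: runs_move; rewrite /offset; lia.
        apply: (runs_seq (c2 := (f2, 0%Z)) (runs_scan_down (B := 4 * S) _ _ _ _)).
        - lia.
        - by move=> a Ha; apply: gM; lia.
        - by [].
        - lia.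
        - by apply: (runs_move (d := TRight)).
        - exact: leqnn.
      exact: leqnn.
    exact: leqnn.
  exact: leqnn.
by lia.
Qed.

Lemma runs_copy m f : copied m f -> 0 < m -> m < N ->
  exists2 f', runs (If is1 (copy_bit true) (copy_bit false))
      (f, (- Z.of_nat m)%Z) (40 * S) (f', (- Z.of_nat m.+1)%Z) & copied m.+1 f'.
Proof.
move=> [fil inp] m0 mN; have S0 := S_gt0 w K_gt0; have KS := K_le w K_gt0.
have mS : m <= S by rewrite /S; nia.
have mKS : m * K + K <= S by rewrite /S; nia.
pose b := nth false w m.
have fb : f (- Z.of_nat m)%Z = Some b by rewrite inp // (nth_map false).
have [f0 fM fT] := filled_shape K_gt0 fil.
pose f1 := upd f (- Z.of_nat m) None.
have f1E a : (a <> - Z.of_nat m)%Z -> f1 a = f a by rewrite /f1 /upd; case: Z.eqb_spec.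
pose e := (Z.of_nat (m * K) + 1)%Z.
have sz c : size (Some b :: nseq K.-1 (Some c)) = K by rewrite /= size_nseq prednK.
have [|f2 R2 [H1 H2]] :=
    @runs_write_cells (Some b :: nseq K.-1 (Some false)) f1 e (e + Z.of_nat K)%Z.
  by rewrite sz.
rewrite sz in R2 H1.
have fil2 : filled w K m.+1 zeros f2.
  apply: (filled_block (m := m) (f := f) (b := b) (c := false)) => //; first by lia.
    by case: (m) m0.
  by move=> a Ha; rewrite H2 ?f1E //; move: Ha; rewrite /e; lia.
pose f3 := upd f2 (- Z.of_nat m) (Some b).
have f3E a : (a <> - Z.of_nat m)%Z -> f3 a = f2 a by rewrite /f3 /upd; case: Z.eqb_spec.
have [g0 gM gT] := filled_shape K_gt0 fil2.
have f2m : f2 (- Z.of_nat m)%Z = None.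
  by rewrite H2 /f1 /upd ?Z.eqb_refl // /e; lia.
have neg a : (- Z.of_nat m < a < 0)%Z -> marked (f a).
  move=> Ha; have -> : a = (- Z.of_nat (Z.to_nat (- a)))%Z by lia.
  by rewrite inp; [apply: nth_marked | ]; lia.
exists f3; last first.
  split.
    case: fil2 => h0 hC hT; split=> [|i j im jK|a Ha]; rewrite f3E //; try lia.
    - exact: hC.
    - by rewrite /addr; lia.
    - exact: hT.
  move=> i i0; case: (altP (i =P m)) => [->|im].
    by rewrite /f3 /upd Z.eqb_refl (nth_map false).
  by rewrite f3E; [rewrite H2 ?f1E ?inp // /e; lia | lia].
apply: (runs_le (B := (39 * S - 2).+2)); last by lia.
apply: runs_if.
have -> : (if is1 (f (- Z.of_nat m)%Z) then copy_bit true else copy_bit false) = copy_bit b.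
  by rewrite fb /is1; case: (b).
have Q1 : runs (scan marked TLeft 1) (f1, (- Z.of_nat m + 1)%Z) (4 * S) (f1, 0%Z).
  apply: runs_scan_up; [lia | | by rewrite f1E // ; lia | lia].
  by move=> a Ha; rewrite f1E; [apply: neg | ]; lia.
have Q2 : runs (scan marked TLeft 1) (f1, 1%Z) (4 * S) (f1, e).
  rewrite /e; apply: runs_scan_up; [lia | | | lia].
    by move=> a Ha; rewrite f1E; [apply: fM | ]; lia.
  by rewrite f1E; [apply: fT | ]; lia.
have Q3 : runs (scan marked TRight 1) (f2, (e + Z.of_nat K - 1)%Z) (4 * S) (f2, 0%Z).
  rewrite /e; apply: runs_scan_down; [lia | | by [] | lia].
  by move=> a Ha; apply: gM; lia.
have Q4 : runs (scan marked TRight 1) (f2, (-1)%Z) (4 * S) (f2, (- Z.of_nat m)%Z).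
  apply: runs_scan_down; [lia | | by [] | lia].
  by move=> a Ha; rewrite H2 ?f1E; [apply: neg | | rewrite /e]; lia.
have M1 : runs (Move TLeft) (f1, (- Z.of_nat m)%Z) 1 (f1, (- Z.of_nat m + 1)%Z) by apply: runs_move.
have M2 : runs (Move TLeft) (f1, 0%Z) 1 (f1, 1%Z) by apply: runs_move.
have M3 : runs (Move TRight) (f2, (e + Z.of_nat K)%Z) 1 (f2, (e + Z.of_nat K - 1)%Z).
  by apply: runs_move; rewrite /offset; lia.
have M4 : runs (Move TRight) (f2, 0%Z) 1 (f2, (-1)%Z) by apply: runs_move.
have M5 : runs (Move TRight) (f3, (- Z.of_nat m)%Z) 1 (f3, (- Z.of_nat m.+1)%Z).
  by apply: runs_move; rewrite /offset; lia.
have W1 : runs (Write None) (f, (- Z.of_nat m)%Z) 1 (f1, (- Z.of_nat m)%Z) by apply: runs_write.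
have W2 : runs (Write (Some b)) (f2, (- Z.of_nat m)%Z) 1 (f3, (- Z.of_nat m)%Z).
  exact: runs_write.
have L := leqnn.
have R := runs_seq M4 (runs_seq Q4 (runs_seq W2 M5 (L _)) (L _)) (L _).
have {}R := runs_seq R2 (runs_seq M3 (runs_seq Q3 R (L _)) (L _)) (L _).
have {}R := runs_seq Q1 (runs_seq M2 (runs_seq Q2 R (L _)) (L _)) (L _).
by apply: (runs_seq W1 (runs_seq M1 R (L _))); lia.
Qed.

Lemma runs_last f : copied N f -> 0 < N ->
  exists2 f', runs last_block (f, (- Z.of_nat N)%Z) (40 * S) (f', 1%Z) & holds w K zeros f'.
Proof.
move=> [fil inp] N0; have S0 := S_gt0 w K_gt0; have KS := K_le w K_gt0.
have NS : N <= S by rewrite /S; nia.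
have NKS : N * K + K <= S by rewrite /S; nia.
have [f0 fM fT] := filled_shape K_gt0 fil.
pose e := (Z.of_nat (N * K) + 1)%Z.
have [|f2 R2 [H1 H2]] :=
    @runs_write_cells (nseq K (Some false)) f e (e + Z.of_nat K)%Z.
  by rewrite size_nseq.
rewrite size_nseq in R2 H1.
have fil2 : filled w K N.+1 zeros f2.
  apply: (filled_block (m := N) (f := f) (b := false) (c := false)) => //.
  - by rewrite nth_default.
  - by case: (N) N0.
  - by move=> i iK; rewrite H1 //; case: (K) K_gt0.
  - by move=> a Ha; rewrite H2 //; move: Ha; rewrite /e; lia.
have [g0 gM gT] := filled_shape K_gt0 fil2.
have neg a : (- Z.of_nat N < a < 0)%Z -> marked (f a).
  move=> Ha; have -> : a = (- Z.of_nat (Z.to_nat (- a)))%Z by lia.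
  by rewrite inp; [apply: nth_marked | ]; lia.
exists f2; last by split.
have Q1 : runs (scan marked TLeft 1) (f, (- Z.of_nat N + 1)%Z) (4 * S) (f, 0%Z).
  apply: runs_scan_up; [lia | | by [] | lia].
  by move=> a Ha; apply: neg; lia.
have Q2 : runs (scan marked TLeft 1) (f, 1%Z) (4 * S) (f, e).
  rewrite /e; apply: runs_scan_up; [lia | | | lia].
    by move=> a Ha; apply: fM; lia.
  by apply: fT; lia.
have Q3 : runs (scan marked TRight 1) (f2, (e + Z.of_nat K - 1)%Z) (4 * S) (f2, 0%Z).
  rewrite /e; apply: runs_scan_down; [lia | | by [] | lia].
  by move=> a Ha; apply: gM; lia.
have M1 : runs (Move TLeft) (f, (- Z.of_nat N)%Z) 1 (f, (- Z.of_nat N + 1)%Z) by apply: runs_move.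
have M2 : runs (Move TLeft) (f, 0%Z) 1 (f, 1%Z) by apply: runs_move.
have M3 : runs (Move TRight) (f2, (e + Z.of_nat K)%Z) 1 (f2, (e + Z.of_nat K - 1)%Z).
  by apply: runs_move; rewrite /offset; lia.
have M4 : runs (Move TLeft) (f2, 0%Z) 1 (f2, 1%Z) by apply: runs_move.
have L := leqnn.
have R := runs_seq R2 (runs_seq M3 (runs_seq Q3 M4 (L _)) (L _)) (L _).
have {}R := runs_seq Q1 (runs_seq M2 (runs_seq Q2 R (L _)) (L _)) (L _).
by apply: (runs_seq M1 R); lia.
Qed.

Lemma runs_prepare : 0 < N ->
  exists2 f, runs prepare (input_tape w) ((N + 2) * (42 * S)) (f, 1%Z) & holds w K zeros f.
Proof.
move=> N0; have S0 := S_gt0 w K_gt0.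
have [f1 R1 C1] := runs_first (erefl _) (erefl _) N0.
have loop d m f : copied m f -> 0 < m -> m + d = N ->
  exists2 f', runs (While marked (If is1 (copy_bit true) (copy_bit false)))
     (f, (- Z.of_nat m)%Z) (d * (42 * S)).+1 (f', (- Z.of_nat N)%Z) & copied N f'.
  elim: d m f => [|d IH] m f C m0 Em.
    have -> : m = N by lia.
    exists f; last by rewrite (_ : N = m) //; lia.
    apply: runs_while_end; case: C => _ ->; last by lia.
    by rewrite nth_default // size_map.
  have [|f' R C'] := runs_copy C m0; first by lia.
  have [||f'' R' C''] := IH m.+1 f' C' => //; first by lia.
  exists f'' => //; apply: runs_le (runs_while _ R R') _; last by lia.
  by case: C => _ ->; [apply: nth_marked; lia | lia].
have [||f2 R2 C2] := loop (N - 1) 1 f1 C1 => //; first by lia.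
have [f3 R3 C3] := runs_last C2 N0.
exists f3 => //; apply: (runs_seq R1 (runs_seq R2 R3 (leqnn _))).
by nia.
Qed.
End Prepare.

(** * First-order formulas on graphs *)

(* Variables are de Bruijn levels: [FEx] binds the level equal to the current depth.
   An atom mentioning an unbound level is false. *)
Inductive fo :=
| FAdj of nat & nat
| FEq of nat & nat
| FNot of fo
| FAnd of fo & fo
| FEx of fo.

Fixpoint sat (E : rel nat) (n : nat) (p : fo) (env : seq nat) : bool :=
  match p with
  | FAdj x y => [&& x < size env, y < size env & E (nth 0 env x) (nth 0 env y)]
  | FEq x y => [&& x < size env, y < size env & nth 0 env x == nth 0 env y]
  | FNot a => ~~ sat E n a env
  | FAnd a b => sat E n a env && sat E n b env
  | FEx a => has (fun v => sat E n a (rcons env v)) (iota 0 n)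
  end.

(* Register 1 holds the number of vertices, 2 the input length, 3 to 5 are scratch;
   [res d] and [var d] hold the truth value at depth [d] and the variable of level [d]. *)
Definition res d := 6 + 2 * d.
Definition var d := 7 + 2 * d.

Definition set_true r := CSeq (CZero r) (CInc r).
(** Adds the value of [m] to register 3: exactly that many loop values lie below it. Nesting this
    once more, [mul] adds a product. Both saturate at the input length. *)
Definition count i m := CFor i (CIfLe m i CSkip (CInc 3)).
Definition mul a b := CFor 4 (CIfLe a 4 CSkip (count 5 b)).
Definition if_true r c := CSeq (CZero 3) (CIfLe r 3 CSkip c).

(** An adjacency is looked up at bit number x n + y. In a conjunction, the second formula overwrites
    the result of the first only if that was true. Loops run up to the input length, so a quantifier
    skips the values that are at least n. *)
Fixpoint check (p : fo) (d : nat) : cmd :=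
  match p with
  | FAdj x y =>
      if (x < d) && (y < d) then
        CSeq (CZero 3) (CSeq (mul (var x) 1) (CSeq (count 4 (var y))
          (CIfBit 3 (set_true (res d)) (CZero (res d)))))
      else CZero (res d)
  | FEq x y =>
      if (x < d) && (y < d) then
        CIfLe (var x) (var y) (CIfLe (var y) (var x) (set_true (res d)) (CZero (res d)))
              (CZero (res d))
      else CZero (res d)
  | FNot a => CSeq (check a d) (CSeq (CZero 3)
                (CIfLe (res d) 3 (set_true (res d)) (CZero (res d))))
  | FAnd a b => CSeq (check a d) (if_true (res d) (check b d))
  | FEx a => CSeq (CZero (res d)) (CFor (var d) (CIfLe 1 (var d) CSkip
               (CSeq (check a d.+1) (if_true (res d.+1) (set_true (res d))))))
  end.

(** Saturating increments bring register 2 to the input length N. As N = n^2, the order n is the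
    number of values v with v^2 < N, and saturation of v^2 at N does not disturb this test. *)
Definition order_of_graph :=
  CSeq (CZero 2) (CSeq (CFor 4 (CInc 2)) (CSeq (CZero 1)
    (CFor 6 (CSeq (CZero 3) (CSeq (mul 6 6) (CIfLe 2 3 CSkip (CInc 1))))))).

(** Ensures that a subformula leaves intact the variables bound outside it, the registers of smaller
    depth, and the order n. *)
Lemma writes_check p d x : writes (check p d) x -> (3 <= x <= 5) || (res d <= x).
Proof.
elim: p d => [y z|y z|a IHa|a IHa b IHb|a IHa] d /=.
- by case: ifP => _ /=; rewrite /res; lia.
- by case: ifP => _ /=; rewrite /res; lia.
- by have := IHa d; case: (writes _ _) => /=; rewrite /res; lia.
- by have := IHa d; have := IHb d; do 2 case: (writes _ _) => /=; rewrite /res; lia.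
- by have := IHa d.+1; rewrite /var; case: (writes _ _) => /=; rewrite /res; lia.
Qed.

Lemma loops_ok_check p d : loops_ok (check p d).
Proof.
elim: p d => [y z|y z|a IHa|a IHa b IHb|a IHa] d /=.
- by case: ifP => _ /=; rewrite ?orbF.
- by case: ifP => _ /=.
- by rewrite IHa.
- by rewrite IHa IHb.
- rewrite IHa /= andbT; apply/negP; have := @writes_check a d.+1 (var d).
  by rewrite /res /var; case: (writes _ _) => /=; lia.
Qed.

Lemma uses_below_check p d : exists K0, forall K, K0 <= K -> uses_below K (check p d).
Proof.
elim: p d => [y z|y z|a IHa|a IHa b IHb|a IHa] d /=.
- by exists (10 + 2 * d + 2 * y + 2 * z) => K HK; case: ifP => _ /=; rewrite /var /res; lia.
- by exists (10 + 2 * d + 2 * y + 2 * z) => K HK; case: ifP => _ /=; rewrite /var /res; lia.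
- have [K0 H] := IHa d; exists (K0 + 10 + 2 * d) => K HK; rewrite H /=; last by lia.
  by rewrite /res; lia.
- have [K0 H] := IHa d; have [K1 H1] := IHb d.
  exists (K0 + K1 + 10 + 2 * d) => K HK; rewrite H ?H1 /= ?andbT; try lia.
  by rewrite /res; lia.
- have [K0 H] := IHa d.+1; exists (K0 + 10 + 2 * d) => K HK; rewrite H /=; last by lia.
  by rewrite /res /var; lia.
Qed.

Lemma crun_for_ind w r a (P : nat -> (nat -> nat) -> Prop) s : P 0 s ->
  (forall v s, v <= size w -> P v s -> P v.+1 (crun w a (setr s r v))) ->
  P (size w).+1 (crun w (CFor r a) s).
Proof.
move=> P0 PS; have : 0 + (size w).+1 <= (size w).+1 by [].
suff H m u t : u + m <= (size w).+1 -> P u t ->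
    P (u + m) (foldl (fun s v => crun w a (setr s r v)) t (iota u m)).
  by move=> le; apply: (H (size w).+1 0 s le P0).
elim: m u t => [|m IH] u t; first by rewrite addn0.
by rewrite addnS -addSn => le Pu; apply: IH => //; apply: PS => //; lia.
Qed.

Lemma crun_le w c s : (forall r, s r <= size w) -> forall r, crun w c s r <= size w.
Proof.
elim: c s => [|r|r|a IHa b IHb|y z a IHa b IHb|y a IHa b IHb|r a IHa] s sN //.
- by move=> x /=; rewrite /setr; case: ifP.
- by move=> x /=; rewrite /setr; case: ifP => // _; apply: geq_minl.
- by apply: IHb; apply: IHa.
- by move=> x /=; case: ifP => _; [apply: IHa | apply: IHb].
- by move=> x /=; case: ifP => _; [apply: IHa | apply: IHb].
- apply: (@crun_for_ind w r a (fun _ s => forall x, s x <= size w)) => // v t vN tN.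
  by apply: IHa => x; rewrite /setr; case: ifP.
Qed.

Lemma crun_count w i m s : i != 3 -> m != 3 -> m != i -> s m <= size w -> s 3 <= size w ->
  crun w (count i m) s 3 = minn (size w) (s 3 + s m).
Proof.
move=> i3 m3 mi sm s3.
pose P v (t : nat -> nat) := t m = s m /\ t 3 = minn (size w) (s 3 + minn v (s m)).
suff [_ ->] : P (size w).+1 (crun w (count i m) s) by congr minn; lia.
apply: crun_for_ind => [|v t vN [tm t3]]; first by split=> //; lia.
rewrite /= setr_eq (setr_neq _ _ mi) tm; case: leqP => le.
  by split; [rewrite setr_neq | rewrite setr_neq 1?eq_sym // t3; lia].
split; first by rewrite !setr_neq.
by rewrite setr_eq setr_neq 1?eq_sym // t3; lia.
Qed.

Lemma crun_mul w a b s : a \notin [:: 3; 4; 5] -> b \notin [:: 3; 4; 5] ->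
  (forall r, s r <= size w) ->
  crun w (mul a b) s 3 = minn (size w) (s 3 + s a * s b).
Proof.
rewrite !inE !negb_or => /and3P[a3 a4 a5] /and3P[b3 b4 b5] sN.
pose P v (t : nat -> nat) := [/\ forall r, t r <= size w, t a = s a, t b = s b &
   t 3 = minn (size w) (s 3 + minn v (s a) * s b)].
suff [_ _ _ ->] : P (size w).+1 (crun w (mul a b) s).
  by have -> : minn (size w).+1 (s a) = s a by have := sN a; lia.
apply: crun_for_ind => [|v t vN [tN ta tb t3]]; first by split=> //; have := sN 3; lia.
have t'N r : setr t 4 v r <= size w by rewrite /setr; case: ifP.
rewrite [crun _ _ _]/= -/(count 5 b) setr_eq (setr_neq _ _ a4) ta; case: leqP => le.
  split=> //; rewrite ?setr_neq // t3.
  by have -> : minn v.+1 (s a) = minn v (s a) by lia.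
change (P v.+1 (crun w (count 5 b) (setr t 4 v))); split.
- exact: crun_le.
- by rewrite crun_frame ?setr_neq //= !negb_or a5 a3.
- by rewrite crun_frame ?setr_neq //= !negb_or b5 b3.
- rewrite crun_count // !setr_neq // tb t3.
  have -> : minn v.+1 (s a) = (minn v (s a)).+1 by lia.
  by rewrite mulSn; lia.
Qed.

Lemma crun_order w n s : size w = n * n -> (forall r, s r <= size w) ->
  crun w order_of_graph s 1 = n.
Proof.
move=> wn sN; set s2 := crun w (CZero 1) (crun w (CFor 4 (CInc 2)) (crun w (CZero 2) s)).
have s2N : forall r, s2 r <= size w by do 3 apply: crun_le.
have E2 : s2 2 = size w.
  rewrite /s2 crun_frame //.
  have -> : size w = minn (size w) (size w).+1 by lia.
  apply: (@crun_for_ind w 4 (CInc 2) (fun v t => t 2 = minn (size w) v)) => [|v t vN /= tv].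
    by rewrite /= minn0.
  by rewrite setr_eq setr_neq // tv; lia.
have E1 : s2 1 = 0 by [].
pose P v (t : nat -> nat) := [/\ forall r, t r <= size w, t 2 = size w & t 1 = minn v n].
have n_le : n <= size w by rewrite wn; nia.
suff [_ _ H] : P (size w).+1 (crun w order_of_graph s) by rewrite H; lia.
apply: (@crun_for_ind w 6 (CSeq (CZero 3) (CSeq (mul 6 6) (CIfLe 2 3 CSkip (CInc 1)))) P s2)
  => [|v t vN [tN t2 t1]]; first by split=> //; rewrite E1; lia.
set t' := crun w (mul 6 6) (crun w (CZero 3) (setr t 6 v)).
have tvN : forall r, crun w (CZero 3) (setr t 6 v) r <= size w.
  by apply: crun_le => r; rewrite /setr; case: ifP.
have t'N : forall r, t' r <= size w by apply: crun_le.
have t'2 : t' 2 = size w by rewrite /t' crun_frame.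
have t'1 : t' 1 = minn v n by rewrite /t' crun_frame.
have t'3 : t' 3 = minn (size w) (v * v) by rewrite /t' crun_mul.
change (P v.+1 (crun w (CIfLe 2 3 CSkip (CInc 1)) t')).
split; first exact: crun_le.
  by rewrite crun_frame.
rewrite /= t'2 t'3; case: leqP => le; first by rewrite t'1; nia.
rewrite setr_eq t'1; nia.
Qed.

Section Check.
Variables (w : seq bool) (n : nat).
Hypotheses (n_gt0 : 0 < n) (wn : size w = n * n).
Let E : rel nat := fun a b => nth false w (a * n + b).

Definition good (env : seq nat) (s : nat -> nat) :=
  [/\ s 1 = n, forall r, s r <= size w & forall i, i < size env -> s (var i) = nth 0 env i].

Lemma good_frame env c s : good env s ->
  (forall x, writes c x -> (1 < x <= 5) || (res (size env) <= x)) -> good env (crun w c s).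
Proof.
move=> [s1 sN sE] H; split; last 1 first.
- move=> i ilt; rewrite crun_frame ?sE //; apply/negP => /H.
  by rewrite /res /var; lia.
- rewrite crun_frame //; apply/negP => /H; by rewrite /res; lia.
- exact: crun_le.
Qed.

Lemma crun_set_true r s : crun w (set_true r) s r = 1.
Proof. by rewrite /= !setr_eq wn; nia. Qed.

Lemma check_correct p env s : all (fun v => v < n) env -> good env s ->
  crun w (check p (size env)) s (res (size env)) = sat E n p env.
Proof.
elim: p env s => [x y|x y|a IHa|a IHa b IHb|a IHa] env s lt_env sG; have [s1 sN sE] := sG.
- rewrite /=; case: ifP => [/andP[xd yd]|nxy]; last first.
    by rewrite /= setr_eq; case: (x < _) nxy => //= ->.
  rewrite xd yd; set s1' := crun w (count 4 (var y)) (crun w (mul (var x) 1) (setr s 3 0)).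
  have xn : nth 0 env x < n by apply: (allP lt_env); rewrite mem_nth.
  have yn : nth 0 env y < n by apply: (allP lt_env); rewrite mem_nth.
  have s0N r : setr s 3 0 r <= size w by rewrite /setr; case: ifP.
  have Ex : s1' 3 = nth 0 env x * n + nth 0 env y.
    rewrite /s1' crun_count //; try exact: crun_le; rewrite /var //.
    rewrite crun_mul // -/(var x) -/(var y) setr_eq.
    rewrite crun_frame; last by rewrite /=.
    rewrite ![setr _ 3 _ _]setr_neq // !sE // s1 wn.
    (* The index of the bit stays below n^2, so neither the product nor the sum saturates. *)
    have : nth 0 env x * n + n <= n * n by nia.
    by lia.
  change (crun w (CIfBit 3 (set_true (res (size env))) (CZero (res (size env)))) s1'
    (res (size env)) = E (nth 0 env x) (nth 0 env y)).
  rewrite /E -Ex /crun -/crun; case: ifP => _; last by rewrite setr_eq.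
  exact: crun_set_true.
- rewrite [check _ _]/= [sat _ _ _ _]/=; case: ifP => [/andP[xd yd]|nxy]; last first.
    by rewrite /= setr_eq; case: (x < _) nxy => //= ->.
  rewrite xd yd /= !sE //; case: ltngtP => _ /=; rewrite ?setr_eq //.
  by rewrite wn; nia.
- rewrite [sat _ _ _ _]/=.
  set t := crun w (check a (size env)) s.
  have -> : crun w (check (FNot a) (size env)) s =
    crun w (CIfLe (res (size env)) 3 (set_true (res (size env))) (CZero (res (size env))))
      (setr t 3 0) by [].
  have Et : t (res (size env)) = sat E n a env by apply: IHa.
  rewrite /crun -/crun setr_eq setr_neq // Et leqn0.
  case: (sat E n a env) => /=; first by rewrite setr_eq.
  exact: crun_set_true.
- rewrite [sat _ _ _ _]/=.
  set t := crun w (check a (size env)) s.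
  have -> : crun w (check (FAnd a b) (size env)) s =
    crun w (CIfLe (res (size env)) 3 CSkip (check b (size env))) (setr t 3 0) by [].
  have Et : t (res (size env)) = sat E n a env by apply: IHa.
  rewrite /crun -/crun setr_eq setr_neq // Et leqn0.
  case: (sat E n a env) Et => /= Et; last by rewrite setr_neq // Et.
  apply: IHb => //; have -> : setr t 3 0 = crun w (CZero 3) t by [].
  apply: good_frame; last by move=> x /= /eqP ->.
  apply: good_frame => // x /writes_check; lia.
have -> : crun w (check (FEx a) (size env)) s =
  crun w (CFor (var (size env)) (CIfLe 1 (var (size env)) CSkip
     (CSeq (check a (size env).+1) (if_true (res (size env).+1) (set_true (res (size env)))))))
    (setr s (res (size env)) 0) by [].
pose h v := sat E n a (rcons env v).
(* Loop invariant: the result is the disjunction over the values treated so far that are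
   vertices. *)
pose P v (t : nat -> nat) := good env t /\ t (res (size env)) = has h (iota 0 (minn v n)).
suff [_ H] : P (size w).+1 (crun w (CFor (var (size env)) (CIfLe 1 (var (size env)) CSkip
     (CSeq (check a (size env).+1) (if_true (res (size env).+1) (set_true (res (size env)))))))
    (setr s (res (size env)) 0)).
  rewrite H /=; congr (nat_of_bool (has _ (iota 0 _))); rewrite wn; nia.
apply: crun_for_ind => [|v t vN [tG tR]].
  split; last by rewrite setr_eq min0n.
  by apply: (good_frame (c := CZero (res (size env)))) => // x /= /eqP ->; rewrite leqnn orbT.
have rv d : res d != var d by rewrite /res /var; lia.
have G1 : good env (setr t (var (size env)) v).
  case: tG => t1 tN tE; split=> [||i lti].
  - by rewrite setr_neq.
  - by move=> r; rewrite /setr; case: ifP.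
  - by rewrite setr_neq ?tE // /var; lia.
have -> : crun w (CIfLe 1 (var (size env)) CSkip
     (CSeq (check a (size env).+1) (if_true (res (size env).+1) (set_true (res (size env))))))
     (setr t (var (size env)) v) =
  if setr t (var (size env)) v 1 <= setr t (var (size env)) v (var (size env))
  then setr t (var (size env)) v
  else crun w (CSeq (check a (size env).+1)
     (if_true (res (size env).+1) (set_true (res (size env))))) (setr t (var (size env)) v).
  by [].
rewrite setr_eq (setr_neq _ _ (isT : 1 != var (size env))) (_ : t 1 = n); last by case: tG.
case: leqP => nv.
  split=> //; rewrite setr_neq // tR.
  by have -> : minn v.+1 n = minn v n by lia.
have G2 : good (rcons env v) (setr t (var (size env)) v).
  case: G1 => u1 uN uE; split=> // i; rewrite size_rcons nth_rcons ltnS leq_eqVlt.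
  case/orP=> [/eqP ->|lti]; first by rewrite setr_eq ltnn eqxx.
  by rewrite lti uE.
set u := setr t (var (size env)) v in G1 G2 *.
set u1 := crun w (check a (size env).+1) u.
have Eu : u1 (res (size env).+1) = h v.
  rewrite /u1 -(size_rcons env v); apply: IHa => //.
  by rewrite all_rcons nv.
have G3 : good env u1.
  apply: good_frame => // x /writes_check; rewrite /res; lia.
have u1R : u1 (res (size env)) = has h (iota 0 v).
  rewrite /u1 crun_frame; last first.
    by apply/negP => /writes_check; rewrite /res; lia.
  rewrite /u setr_neq // tR; congr (nat_of_bool (has _ (iota 0 _))); lia.
rewrite /P; have -> : minn v.+1 n = v.+1 by lia.
rewrite -[v.+1]addn1 iotaD has_cat add0n [has _ (iota v 1)]/= orbF.
have -> : crun w (CSeq (check a (size env).+1) (if_true (res (size env).+1)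
    (set_true (res (size env))))) u =
  if setr u1 3 0 (res (size env).+1) <= setr u1 3 0 3 then setr u1 3 0
  else crun w (set_true (res (size env))) (setr u1 3 0) by [].
have G4 : good env (setr u1 3 0).
  by apply: (good_frame (c := CZero 3)) => // x /= /eqP ->.
rewrite setr_eq setr_neq // Eu leqn0; case: (h v) => /=; last first.
  by split=> //; rewrite orbF setr_neq.
rewrite orbT; split; last exact: crun_set_true.
apply: (good_frame (c := set_true (res (size env)))) => // x /=.
by rewrite orbb => /eqP ->; rewrite leqnn orbT.
Qed.
End Check.

Definition checker (p : fo) := CSeq order_of_graph (check p 0).

(** The final moves lead to block 1 on the track of [res 0], which is marked exactly when the result
    is 1. *)
Definition checker_prog (K : nat) (p : fo) :=
  If blank Skip (Seq (prepare K) (Seq (compile K (checker p)) (moves TLeft (K + res 0)))).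

(** For n = 0 the input is empty and the program halts at once on a blank, which counts as no; hence
    the conjunct [0 < n]. *)
Lemma fo_decidable (p : fo) : exists M c k,
  forall w n, size w = n * n ->
    tm_decides_in M w (c * (size w).+1 ^ k)
      ((0 < n) && sat (fun a b => nth false w (a * n + b)) n p [::]).
Proof.
have [K0 HK0] := uses_below_check p 0.
pose K := K0 + 10; have K_gt0 : 0 < K by rewrite /K; lia.
have [A [k HA]] := ctime_poly K (checker p).
exists (machine (checker_prog K p)), (2 + 168 * K + A + (K + 6)), (2 + k) => w n wn.
have pow_gt0 j : 0 < (size w).+1 ^ j by rewrite expn_gt0.
case: (posnP n) => [n0|n_gt0].
  have w0 : w = [::] by apply/nilP; rewrite /nilp wn n0.
  rewrite w0; apply: (machine_decides (T := 2) (c := input_tape [::])).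
    by apply: ExIfT => //; constructor.
  by have := pow_gt0 (2 + k); rewrite w0; nia.
have N_gt0 : 0 < size w by rewrite wn; nia.
have [f1 R1 H1] := runs_prepare K_gt0 N_gt0.
have [||f2 R2 H2] := compile_correct (c := checker p) K_gt0 _ _ H1.
- by rewrite /= HK0 /K; lia.
- by rewrite /= loops_ok_check.
have z0N r : zeros r <= size w by [].
have G : good w n [::] (crun w order_of_graph zeros).
  by split=> //; [apply: crun_order | apply: crun_le].
have Er : crun w (checker p) zeros (res 0) =
    sat (fun a b => nth false w (a * n + b)) n p [::].
  exact: (@check_correct w n n_gt0 wn p [::]).
have R3 : runs (moves TLeft (K + res 0)) (f2, 1%Z) (K + 6) (f2, addr K 1 (res 0)).
  by apply: runs_moves; rewrite /addr /offset; lia.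
have R4 := runs_seq R1 (runs_seq R2 R3 (leqnn _)) (leqnn _).
have [T ET leT] : runs (checker_prog K p) (input_tape w)
    ((size w + 2) * (42 * ((size w + 2) * K)) + (ctime w K (checker p) + (K + 6))).+2
    (f2, addr K 1 (res 0)).
  by apply: runs_if; rewrite /blank /=; case: (w) N_gt0 R4.
rewrite andTb; have <- : ((f2, addr K 1 (res 0)).1 (f2, addr K 1 (res 0)).2 == Some true) =
    sat (fun a b => nth false w (a * n + b)) n p [::].
  rewrite /fst /snd; case: H2 => -[_ fC _] _; rewrite fC //; last by rewrite /K /res; lia.
  by rewrite /cell Er /=; case: (sat _ _ _ _).
apply: (machine_decides ET); apply: leq_trans leT _.
have := HA w; have := pow_gt0 k; rewrite expnD.
set x := (size w).+1 ^ k => x0 Hc.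
(* The factor 168 is 42 times 4: each [size w + 2] is at most twice [(size w).+1]. *)
have Ew : (size w + 2) * (42 * ((size w + 2) * K)) <= 168 * K * (size w).+1 ^ 2.
  rewrite (_ : (size w).+1 ^ 2 = (size w).+1 * (size w).+1) ?expnS ?expn0 ?muln1 //.
  have : size w + 2 <= 2 * (size w).+1 by lia.
  move: (size w + 2) (size w).+1 => a b ab.
  have : a * a <= 4 * (b * b) by nia.
  by nia.
have sq : 0 < (size w).+1 ^ 2 by [].
move: Ew sq; set y := (size w).+1 ^ 2 => Ew y0.
have y1 : 168 * K * y <= 168 * K * (y * x) by rewrite leq_mul2l; apply/orP; right; nia.
have x1 : A * x <= A * (y * x) by rewrite leq_mul2l; apply/orP; right; nia.
have yx : 0 < y * x by rewrite muln_gt0 y0.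
have K1 : K + 6 <= (K + 6) * (y * x) by rewrite leq_pmulr.
by rewrite !mulnDl; rewrite -/x in Hc; move: K1; rewrite mulnDl; lia.
Qed.

Lemma nth_allpairs (T U R : Type) (f : T -> U -> R) (s : seq T) (t : seq U) x0 y0 z0 i j :
  i < size s -> j < size t ->
  nth z0 [seq f x y | x <- s, y <- t] (i * size t + j) = f (nth x0 s i) (nth y0 t j).
Proof.
move=> + jt; elim: s i => // x s IH [|i] /= lti; rewrite nth_cat size_map.
  by rewrite mul0n add0n jt (nth_map y0).
rewrite ltnNge mulSn -addnA leq_addr /= addKn; exact: IH.
Qed.

Lemma size_encode n (e : rel 'I_n) : size (encode_graph e) = n * n.
Proof. by rewrite size_allpairs size_enum_ord. Qed.

Lemma nth_encode n (e : rel 'I_n) (i j : 'I_n) :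
  nth false (encode_graph e) (i * n + j) = e i j.
Proof.
have /= := @nth_allpairs _ _ _ (fun x y => e x y) (enum 'I_n) (enum 'I_n) i i false i j.
by rewrite size_enum_ord => ->; rewrite ?nth_ord_enum ?ltn_ord.
Qed.

Definition FOr a b := FNot (FAnd (FNot a) (FNot b)).
Definition FAll a := FNot (FEx (FNot a)).
(** [FEq 0 0] is false when no level is bound, so its negation alone would not be a
    contradiction. *)
Definition FFalse := FAnd (FEq 0 0) (FNot (FEq 0 0)).
Definition FTrue := FNot FFalse.
Definition ors := foldr FOr FFalse.
Definition ands := foldr FAnd FTrue.

Section Sat.
Variables (E : rel nat) (n : nat).
Notation sat := (sat E n).

Lemma sat_and a b env : sat (FAnd a b) env = sat a env && sat b env.
Proof. by []. Qed.

Lemma sat_not a env : sat (FNot a) env = ~~ sat a env.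
Proof. by []. Qed.

Lemma sat_ex a env : sat (FEx a) env = has (fun v => sat a (rcons env v)) (iota 0 n).
Proof. by []. Qed.

Lemma sat_eq x y env : x < size env -> y < size env ->
  sat (FEq x y) env = (nth 0 env x == nth 0 env y).
Proof. by rewrite /= => -> ->. Qed.

Lemma sat_or a b env : sat (FOr a b) env = sat a env || sat b env.
Proof. by rewrite /= negb_and !negbK. Qed.

Lemma sat_all a env : sat (FAll a) env = all (fun v => sat a (rcons env v)) (iota 0 n).
Proof. by rewrite /= -all_predC; apply: eq_all => v /=; rewrite negbK. Qed.

Lemma sat_true env : sat FTrue env.
Proof. by rewrite /= andbN. Qed.

Lemma sat_ors l env : sat (ors l) env = has (fun a => sat a env) l.
Proof. by elim: l => [|a l IH]; [rewrite /= andbN | rewrite [ors _]/= sat_or IH]. Qed.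

Lemma sat_ands l env : sat (ands l) env = all (fun a => sat a env) l.
Proof. by elim: l => [|a l IH]; [rewrite [ands _]/= sat_true | rewrite /= IH]. Qed.

Lemma sat_exs m a env : reflect
  (exists vs, [/\ size vs = m, all (fun v => v < n) vs & sat a (env ++ vs)])
  (sat (iter m FEx a) env).
Proof.
elim: m env => [|m IH] env.
  apply: (iffP idP) => [H|[vs [/size0nil -> _]]]; last by rewrite cats0.
  by exists [::]; rewrite cats0.
rewrite iterS; apply: (iffP hasP)
  => [[v vn /IH[vs [sz ltn H]]]|[[|v vs] [//= [sz] /andP[vn ltn] H]]].
  exists (v :: vs); rewrite /= sz ltn -cat_rcons; split=> //.
  by move: vn; rewrite mem_iota andbT.
exists v; first by rewrite mem_iota.
by apply/IH; exists vs; rewrite cat_rcons.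
Qed.
End Sat.

Lemma map_nth_cat (env vs : seq nat) :
  vs = [seq nth 0 (env ++ vs) x | x <- iota (size env) (size vs)].
Proof.
apply: (@eq_from_nth _ 0); first by rewrite size_map size_iota.
move=> i lti; rewrite (nth_map 0) ?size_iota // nth_iota // nth_cat.
by rewrite ltnNge leq_addr /= addKn.
Qed.

(** * Semitotal domination as a first-order formula *)

Section SemitotalFormula.
Variables (adj : nat -> nat -> fo) (dom : nat -> fo).

(** [d] is the current depth, hence the level bound by each quantifier in the body. Adjacency and
    vertex set are parameters, so that the same formula speaks of [G] and of a contraction defined
    inside [G]. *)
Definition semitotal_fo (d : nat) (xs : seq nat) :=
  FAnd (FAll (FOr (FNot (dom d)) (ors [seq FOr (FEq d y) (adj d y) | y <- xs])))
       (ands [seq ors [seq FAnd (FNot (FEq x y))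
          (FOr (adj x y) (FEx (FAnd (dom d) (FAnd (adj x d) (adj d y))))) | y <- xs] | x <- xs]).

(** The [m] quantified vertices may coincide, so this expresses size at most [m]. *)
Definition has_semitotal_fo (d m : nat) :=
  iter m FEx (FAnd (ands (map dom (iota d m))) (semitotal_fo (d + m) (iota d m))).

Variables (E : rel nat) (n : nat) (env0 : seq nat) (A : rel nat) (P : pred nat).
Hypothesis sat_adj : forall env x y, x < size (env0 ++ env) -> y < size (env0 ++ env) ->
  sat E n (adj x y) (env0 ++ env) = A (nth 0 (env0 ++ env) x) (nth 0 (env0 ++ env) y).
Hypothesis sat_dom : forall env x, x < size (env0 ++ env) ->
  sat E n (dom x) (env0 ++ env) = P (nth 0 (env0 ++ env) x).

Definition semitotal_seq (vs : seq nat) :=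
  all (fun a => ~~ P a || has (fun b => (a == b) || A a b) vs) (iota 0 n) &&
  all (fun a => has (fun b => (a != b) &&
     (A a b || has (fun c => [&& P c, A a c & A c b]) (iota 0 n))) vs) vs.

Lemma sat_semitotal_fo vs :
  sat E n (semitotal_fo (size env0 + size vs) (iota (size env0) (size vs))) (env0 ++ vs) =
  semitotal_seq vs.
Proof.
set xs := iota _ _; set d := size env0 + _.
have Evs : vs = [seq nth 0 (env0 ++ vs) x | x <- xs] by apply: map_nth_cat.
have sz : size (env0 ++ vs) = d by rewrite size_cat.
have xd x : x \in xs -> x < d by rewrite mem_iota => /andP[].
have nr v x : x < d -> nth 0 (env0 ++ rcons vs v) x = nth 0 (env0 ++ vs) x.
  by move=> ltx; rewrite -rcons_cat nth_rcons sz ltx.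
have nd v : nth 0 (env0 ++ rcons vs v) d = v.
  by rewrite -rcons_cat nth_rcons sz ltnn eqxx.
have szr v : size (env0 ++ rcons vs v) = d.+1 by rewrite size_cat size_rcons addnS.
have ltr x : x < d -> x < d.+1 by apply: leqW.
rewrite /semitotal_fo sat_and sat_all sat_ands; congr (_ && _).
  apply: eq_in_all => v _; rewrite sat_or sat_not rcons_cat sat_dom ?szr // nd sat_ors.
  congr (_ || _); rewrite [in RHS]Evs !has_map; apply: eq_in_has => x /xd ltx.
  change (sat E n (FOr (FEq d x) (adj d x)) (env0 ++ rcons vs v) =
    (v == nth 0 (env0 ++ vs) x) || A v (nth 0 (env0 ++ vs) x)).
  by rewrite sat_or sat_eq ?sat_adj ?szr ?ltnSn ?ltr // nd nr.
rewrite [in RHS]Evs !all_map; apply: eq_in_all => x /xd ltx.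
rewrite /preim /= sat_ors [in RHS]Evs !has_map; apply: eq_in_has => y /xd lty.
rewrite /preim; cbv beta; rewrite [LHS]sat_and sat_not sat_or sat_ex sat_eq ?sat_adj ?sz // -!Evs.
congr (_ && (_ || _)); apply: eq_in_has => v _.
by rewrite !sat_and rcons_cat sat_dom ?sat_adj ?szr ?ltnSn ?ltr // nd !nr.
Qed.

Lemma has_semitotal_foP m : reflect
  (exists vs, [/\ size vs = m, all (fun v => v < n) vs, all P vs & semitotal_seq vs])
  (sat E n (has_semitotal_fo (size env0) m) env0).
Proof.
have key vs : size vs = m -> sat E n (FAnd (ands (map dom (iota (size env0) m)))
    (semitotal_fo (size env0 + m) (iota (size env0) m))) (env0 ++ vs) =
    all P vs && semitotal_seq vs.
  move=> sz; rewrite sat_and -sz sat_semitotal_fo; congr (_ && _).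
  rewrite sat_ands all_map.
  rewrite [in RHS](map_nth_cat env0 vs).
  rewrite all_map; apply: eq_in_all => x; rewrite mem_iota => /andP[_ ltx] /=.
  by rewrite sat_dom // size_cat.
apply: (iffP (sat_exs _ _ _ _ _)) => -[vs [sz ltn H]].
  by rewrite key // in H; have [? ?] := andP H; exists vs.
by move=> H'; exists vs; split=> //; rewrite key // H.
Qed.

(** [code] identifies the vertices of [H] with the numbers below [n] that satisfy [P], so lists of
    numbers and vertex sets correspond up to repetition. *)
Lemma semitotal_seqP (H : sgraph) (code : sV H -> nat) m : injective code ->
  (forall x, (code x < n) && P (code x)) ->
  (forall a, a < n -> P a -> exists x, code x = a) ->
  (forall x y, A (code x) (code y) = @sadj H x y) -> 0 < #|sV H| ->
  (exists vs, [/\ size vs = m, all (fun v => v < n) vs, all P vs & semitotal_seq vs]) <->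
  exists2 D : {set sV H}, semitotal_dom D & #|D| <= m.
Proof.
move=> inj codeP codeS codeA H0.
have key vs (D : {set sV H}) : all (fun v => v < n) vs -> all P vs ->
    (forall x, (x \in D) = (code x \in vs)) -> semitotal_seq vs = semitotal_dom D.
  move=> ltn allP' memD.
  have codeV a : a \in vs -> exists2 x, code x = a & x \in D.
    move=> avs; have [x Ex] := codeS a (allP ltn a avs) (allP allP' a avs).
    by exists x => //; rewrite memD Ex.
  rewrite /semitotal_seq /semitotal_dom; congr (_ && _).
    apply/allP/forallP => [h x|h a].
      apply/implyP => xD; have /andP[xn xP] := codeP x.
      have := h (code x); rewrite mem_iota xn xP => /(_ isT)/hasP[b bvs].
      have [y Ey yD] := codeV b bvs; rewrite -Ey (inj_eq inj) codeA => xy.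
      apply/existsP; exists y; rewrite yD; case/orP: xy => // /eqP Exy.
      by rewrite Exy yD in xD.
    rewrite mem_iota add0n => an; case Pa: (P a) => //=.
    have [x Ex] := codeS a an Pa; case: (boolP (x \in D)) => xD.
      by apply/hasP; exists a; rewrite ?eqxx // -Ex -memD.
    have /implyP/(_ xD)/existsP[y /andP[yD xy]] := h x.
    by apply/hasP; exists (code y); rewrite -?memD // -Ex codeA xy orbT.
  have w2 x y : (code x != code y) && (A (code x) (code y) ||
       has (fun c => [&& P c, A (code x) c & A c (code y)]) (iota 0 n)) = within2 x y.
    rewrite /within2 (inj_eq inj) codeA; congr (_ && (_ || _)).
    apply/hasP/existsP => [[c]|[z /andP[xz zy]]].
      rewrite mem_iota => cn /and3P[Pc xc cy]; have [z Ez] := codeS c cn Pc.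
      by exists z; rewrite -!codeA Ez xc cy.
    have /andP[zn zP] := codeP z; exists (code z); first by rewrite mem_iota.
    by rewrite zP !codeA xz zy.
  apply/allP/forallP => [h x|h a avs].
    apply/implyP => xD; have := h (code x); rewrite -memD => /(_ xD)/hasP[b bvs].
    have [y Ey yD] := codeV b bvs; rewrite -Ey w2 => xy.
    by apply/existsP; exists y; rewrite yD.
  have [x Ex xD] := codeV a avs; have /implyP/(_ xD)/existsP[y /andP[yD xy]] := h x.
  by apply/hasP; exists (code y); rewrite -?memD // -Ex w2.
split=> [[vs [sz ltn allP' sv]]|[D sD leD]].
  exists [set x | code x \in vs]; first by rewrite -(key vs) // => x; rewrite inE.
  rewrite -sz cardE -(size_map code); apply: uniq_leq_size.
    by rewrite map_inj_uniq ?enum_uniq.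
  by move=> a /mapP[x]; rewrite mem_enum inE => ? ->.
(* A smaller set is padded to length [m] by repeating one of its members; one exists because [D]
   dominates a nonempty graph. *)
have [x0 x0D] : exists x, x \in D.
  case/card_gt0P: H0 => x _; case: (boolP (x \in D)) => xD; first by exists x.
  have /andP[/forallP/(_ x)/implyP/(_ xD)/existsP[y /andP[yD _]] _] := sD.
  by exists y.
pose vs := [seq code x | x <- enum D] ++ nseq (m - #|D|) (code x0).
have memD x : (x \in D) = (code x \in vs).
  rewrite mem_cat mem_map // mem_enum mem_nseq (inj_eq inj).
  by case: eqP => [->|]; rewrite ?x0D ?andbF ?orbF.
have all_code (Q : pred nat) : (forall x, Q (code x)) -> all Q vs.
  by move=> QC; rewrite all_cat all_nseq QC orbT andbT; apply/allP => a /mapP[x _ ->].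
have ltn : all (fun v => v < n) vs by apply: all_code => x; case/andP: (codeP x).
have allP' : all P vs by apply: all_code => x; case/andP: (codeP x).
exists vs; split=> //; last by rewrite (key _ D).
by rewrite size_cat size_map -cardE size_nseq subnKC.
Qed.
End SemitotalFormula.

(* The contracted edge is carried by the levels 0 and 1. *)
Definition contract_adj x y :=
  FAnd (FNot (FEq x y))
    (FOr (FAdj x y) (FOr (FAnd (FEq x 0) (FAdj 1 y)) (FAnd (FEq y 0) (FAdj x 1)))).
Definition contract_dom x := FNot (FEq x 1).

Definition small_set m := has_semitotal_fo FAdj (fun _ => FTrue) 0 m.
Definition small_contracted m :=
  FEx (FEx (FAnd (FAdj 0 1) (has_semitotal_fo contract_adj contract_dom 2 m))).

(** The conjunct [FTrue] puts the existence of an edge into the form treated by [sat_edges], which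
    also covers [small_contracted]. *)
Definition ct_formula t :=
  FOr (ors [seq FAnd (small_contracted m) (FNot (small_set m)) | m <- iota 0 (2 * t + 5)])
      (FAnd (FEx (FEx (FAnd (FAdj 0 1) FTrue))) (FNot (small_set (2 * t + 5)))).

(** * The sentence evaluated on encoded graphs *)

Section Encoded.
Variables (n : nat) (e : rel 'I_n).
Hypothesis n_gt0 : 0 < n.
Let G := SGraph e.
Let E : rel nat := fun a b => nth false (encode_graph e) (a * n + b).

Lemma small_setP m : sat E n (small_set m) [::] <->
  exists2 D : {set 'I_n}, @semitotal_dom G D & #|D| <= m.
Proof.
have h1 env x y : x < size ([::] ++ env) -> y < size ([::] ++ env) ->
  sat E n (FAdj x y) ([::] ++ env) = E (nth 0 ([::] ++ env) x) (nth 0 ([::] ++ env) y).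
  by move=> /= -> ->.
have h2 env x : x < size ([::] ++ env) ->
  sat E n FTrue ([::] ++ env) = predT (nth 0 ([::] ++ env) x) by rewrite sat_true.
apply: iff_trans (iff_sym (rwP (has_semitotal_foP h1 h2 m))) _.
apply: (@semitotal_seqP n E predT G (fun x : 'I_n => x)) => //.
- exact: val_inj.
- by move=> x; rewrite ltn_ord.
- by move=> a an _; exists (Ordinal an).
- by move=> x y; apply: nth_encode.
- by rewrite card_ord.
Qed.

Lemma sat_edges a : sat E n (FEx (FEx (FAnd (FAdj 0 1) a))) [::] <->
  exists u v : 'I_n, e u v /\ sat E n a [:: u : nat; v : nat].
Proof.
rewrite sat_ex; split=> [/hasP[u]|[u [v [uv H]]]].
  rewrite mem_iota sat_ex => un /hasP[v]; rewrite mem_iota => vn.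
  rewrite sat_and => /andP[uv H]; exists (Ordinal (un : u < n)), (Ordinal (vn : v < n)).
  by split=> //; rewrite -nth_encode.
apply/hasP; exists (u : nat); first by rewrite mem_iota ltn_ord.
rewrite sat_ex; apply/hasP; exists (v : nat); first by rewrite mem_iota ltn_ord.
by rewrite sat_and H andbT; rewrite -nth_encode in uv.
Qed.

Hypothesis irr_e : irreflexive e.

Lemma small_contractedP m : sat E n (small_contracted m) [::] <->
  exists u v, e u v /\
    exists2 D : {set sV (@contract G u v)}, semitotal_dom D & #|D| <= m.
Proof.
suff key (u v : 'I_n) : e u v ->
  sat E n (has_semitotal_fo contract_adj contract_dom 2 m) [:: u : nat; v : nat] <->
  exists2 D : {set sV (@contract G u v)}, semitotal_dom D & #|D| <= m.
  apply: iff_trans (sat_edges _) _.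
  by split=> -[u [v [uv H]]]; exists u, v; split=> //; apply/(key u v uv).
move=> uv; have nuv : u != v by apply: contraTneq uv => ->; rewrite irr_e.
pose A (a b : nat) := (a != b) && [|| E a b, (a == u) && E v b | (b == u) && E a v].
have h1 env x y : x < size ([:: u : nat; v : nat] ++ env) ->
    y < size ([:: u : nat; v : nat] ++ env) ->
    sat E n (contract_adj x y) ([:: u : nat; v : nat] ++ env) =
    A (nth 0 ([:: u : nat; v : nat] ++ env) x) (nth 0 ([:: u : nat; v : nat] ++ env) y).
  move=> xs ys; rewrite /contract_adj sat_and sat_not !sat_or !sat_and !sat_eq //.
  by rewrite [sat _ _ (FAdj x y) _]/= [sat _ _ (FAdj 1 y) _]/= [sat _ _ (FAdj x 1) _]/= xs ys.
have h2 env x : x < size ([:: u : nat; v : nat] ++ env) ->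
    sat E n (contract_dom x) ([:: u : nat; v : nat] ++ env) =
    (nth 0 ([:: u : nat; v : nat] ++ env) x != v).
  by move=> xs; rewrite /contract_dom sat_not sat_eq.
apply: iff_trans (iff_sym (rwP (has_semitotal_foP (P := fun a => a != v) h1 h2 m))) _.
apply: (@semitotal_seqP n A (fun a => a != v) (@contract G u v) (fun x => val (val x))).
- by move=> x y /val_inj/val_inj.
- by move=> x; rewrite ltn_ord; apply: (valP x).
- by move=> a an av; exists (Sub (Ordinal an) av).
- by move=> x y; rewrite /A /E !nth_encode.
- by apply/card_gt0P; exists (Sub u nuv).
Qed.

Lemma ct_formulaP t : sat E n (ct_formula t) [::] <->
  (exists2 m, m < 2 * t + 5 &
     (exists u v, e u v /\
        exists2 D : {set sV (@contract G u v)}, semitotal_dom D & #|D| <= m) /\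
     ~ (exists2 D : {set 'I_n}, @semitotal_dom G D & #|D| <= m)) \/
  (exists x y, e x y) /\
  ~ (exists2 D : {set 'I_n}, @semitotal_dom G D & #|D| <= 2 * t + 5).
Proof.
have not_small m : sat E n (FNot (small_set m)) [::] <->
    ~ (exists2 D : {set 'I_n}, @semitotal_dom G D & #|D| <= m).
  rewrite sat_not; split=> [/negP H /small_setP //|H].
  by apply/negP => /small_setP.
rewrite /ct_formula sat_or sat_ors has_map sat_and.
split=> [/orP[/hasP[m]|/andP[/sat_edges[u [v [uv _]]] /not_small nS]]|].
- rewrite mem_iota => mB; rewrite /preim /= => /andP[/small_contractedP H /not_small nS].
  by left; exists m.
- by right; split=> //; exists u, v.
case=> [[m mB [H nS]]|[[u [v uv]] nS]]; apply/orP.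
  left; apply/hasP; exists m; first by rewrite mem_iota.
  by apply/andP; split; [apply/small_contractedP | apply/not_small].
right; apply/andP; split; last exact/not_small.
by apply/sat_edges; exists u, v; rewrite sat_true.
Qed.
End Encoded.

Theorem theorem15 : forall t : nat,
  exists (M : TM) (c k : nat),
    forall (n : nat) (e : rel 'I_n),
      symmetric e -> irreflexive e -> (forall x y, connect e x y) ->
      Hfree (P5tK1 t) (SGraph e) ->
      exists b : bool,
        tm_decides_in M (encode_graph e) (c * (size (encode_graph e)).+1 ^ k) b /\
        (b = true <-> ct_gt2_le (SGraph e) 1).
Proof.
move=> t; have [M [c [k H]]] := fo_decidable (ct_formula t).
exists M, c, k => n e sym irr conn free.
eexists; split; first exact: H (size_encode e).
have crit := ct_le1_criterion sym irr conn free.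
(* The hypotheses also admit the empty graph, where connectivity is vacuous. The machine answers no,
   and both sides of the criterion fail for want of an edge. *)
case: (posnP n) => [n0|n_gt0]; last first.
  by rewrite andTb; apply: iff_trans (ct_formulaP n_gt0 irr t) (iff_sym crit).
have void (u : 'I_n) : False by move: (ltn_ord u); rewrite {2}n0.
by split=> // /crit[[m _ [[u _] _]]|[[u _] _]]; case: (void u).
Qed.
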